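(* Let $1<\alpha\le 2\le\beta<\infty$ and $K\ge 1$, and let $\Psi\colon\mathbb{R}^n\to\mathbb{R}$ satisfy condition (C) and the growth condition $(G_{K,\alpha,\beta})$ (both defined in the context). Let $D,d\ge 0$ and let $\mu$ be a probability measure on $\mathbb{R}^n$, absolutely continuous with respect to Lebesgue measure, satisfying the defective modified logarithmic Sobolev inequality $dmLSI(\Psi,D,d)$. Then for all locally Lipschitz functions $f\colon\mathbb{R}^n\to\mathbb{R}$ and all $p\ge\beta$, $$\|f\|_p\le e^{2d/\beta}\|f\|_\beta+\frac{2e}{\alpha-1}\Big((KD)^{1/\alpha}\vee(KD)^{1/\beta}\Big)\Big\||\nabla f|_{\Psi_p}\Big\|_p .$$
   Context: Condition (C) for $\Psi\colon\mathbb{R}^n\to[0,\infty]$: (C1) $\Psi(0)=0$ and $\Psi$ is continuous at $0$; (C2) $\Psi(x)>0$ for $x\ne0$; (C3) $\lim_{|x|\to\infty}\Psi(x)=\infty$; (C4) for every $x\in\mathbb{R}^n$ the function $t\mapsto\Psi(tx)$ is left-continuous on $(0,\infty)$; (C5) for every $x\in\mathbb{R}^n$ the function $t\mapsto\Psi(tx)/t$ is non-decreasing on $(0,\infty)$; (C6) $\Psi(x)=\Psi(-x)$ for all $x$. Growth condition $(G_{K,\alpha,\beta})$: for all $x\in\mathbb{R}^n\setminus\{0\}$ and all $t\ge1$, $K^{-1}t^\alpha\le\Psi(tx)/\Psi(x)\le Kt^\beta$. $dmLSI(\Psi,D,d)$: for every bounded locally Lipschitz $f\colon\mathbb{R}^n\to(0,\infty)$,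 $$\mathrm{Ent}_\mu f^2\le D\,\mathbb{E}_\mu\Psi\Big(\frac{\nabla f}{f}\Big)f^2+d\,\mathbb{E}_\mu f^2,$$ where $\mathbb{E}_\mu$ is integration with respect to $\mu$ and $\mathrm{Ent}_\mu g=\mathbb{E}_\mu g\log g-\mathbb{E}_\mu g\log\mathbb{E}_\mu g$ for $g\ge 0$. Gradients of locally Lipschitz functions exist Lebesgue-a.e., hence $\mu$-a.e. Norms: for $p>0$, $\Psi_p(x)=\frac1p\Psi(px)$ and $|x|_{\Psi_p}=\inf\{a>0:\Psi_p(x/a)\le1\}$ for $x\in\mathbb{R}^n$ (a quasi-norm). Moments: $\|g\|_p=(\mathbb{E}_\mu|g|^p)^{1/p}$ (possibly $+\infty$). $a\vee b=\max(a,b)$. *)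

(* Defs.v *)
From HB Require Import structures.
From mathcomp Require Import all_boot all_order all_algebra.
From mathcomp Require Import all_classical all_reals all_analysis.
Set Implicit Arguments.
Unset Strict Implicit.
Unset Printing Implicit Defensive.
Import Order.TTheory GRing.Theory Num.Theory.
Import numFieldNormedType.Exports.
Local Open Scope classical_set_scope.
Local Open Scope ring_scope.

(* 'rV[R]_n has no measurable structure in the library; this is R^n with its
   Borel sigma-algebra. *)
Notation borel_rV R n := (g_sigma_algebraType (@open 'rV[R]_n)).

(* Lebesgue measure on R^n: the n-fold product of the one-dimensional one,
   built on n-tuples (dirac for n = 0) and transported to row vectors. *)
Section lebesgue_measure_rV.
Context {R : realType}.
Local Open Scope ereal_scope.

Local Notation T := (measurableTypeR R).

Definition cons_pair n (p : T * n.-tuple T) : n.+1.-tuple T :=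
  [tuple of p.1 :: p.2].

Lemma measurable_cons_pair n : measurable_fun setT (@cons_pair n).
Proof. exact: measurable_cons. Qed.

Section step.
Variables (n : nat) (mu : {sigma_finite_measure set (n.-tuple T) -> \bar R}).

HB.instance Definition _ :=
  isMeasurableFun.Build _ _ _ _ (@cons_pair n) (@measurable_cons_pair n).

Definition lebesgue_cons : set (n.+1.-tuple T) -> \bar R :=
  pushforward (lebesgue_measure \x mu) (@cons_pair n).

Let lebesgue_cons0 : lebesgue_cons set0 = 0.
Proof. exact: measure0. Qed.

Let lebesgue_cons_ge0 A : 0 <= lebesgue_cons A.
Proof. exact: measure_ge0. Qed.

Let lebesgue_cons_sigma_additive : semi_sigma_additive lebesgue_cons.
Proof. exact: measure_semi_sigma_additive. Qed.

HB.instance Definition _ := isMeasure.Build _ _ _ lebesgue_cons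
  lebesgue_cons0 lebesgue_cons_ge0 lebesgue_cons_sigma_additive.

Let lebesgue_cons_sigma_finite : sigma_finite setT lebesgue_cons.
Proof.
have /sigma_finiteP[F [TF ndF Foo]] :=
  @sigma_finiteT _ T R (@lebesgue_measure R).
have /sigma_finiteP[G [TG ndG Goo]] := @sigma_finiteT _ _ _ mu.
pose g (t : n.+1.-tuple T) : T * n.-tuple T := (thead t, [tuple of behead t]).
have gK : cancel (@cons_pair n) g.
  by case=> a t; rewrite /g/= theadE; congr pair; apply: val_inj.
have mg : measurable_fun setT g.
  apply/measurable_fun_pair; first exact: measurable_tnth.
  exact: measurable_behead.
exists (fun k => g @^-1` (F k `*` G k)).
  apply/seteqP; split=> // t _.
  have [k _ Fk] : (\bigcup_k F k) (g t).1 by rewrite -TF.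
  have [l _ Gl] : (\bigcup_k G k) (g t).2 by rewrite -TG.
  exists (maxn k l) => //; split.
    by move: Fk; exact/subsetPset/ndF/leq_maxl.
  by move: Gl; exact/subsetPset/ndG/leq_maxr.
move=> k; have [mF Fk] := Foo k; have [mG Gk] := Goo k; split.
  by rewrite -[_ @^-1` _]setTI; apply: mg => //; exact: measurableX.
rewrite /lebesgue_cons /pushforward -comp_preimage.
rewrite (_ : g \o _ = id); last by apply/funext => p; exact: gK.
by rewrite product_measure1E// lte_mul_pinfty// ge0_fin_numE.
Qed.

HB.instance Definition _ :=
  Measure_isSigmaFinite.Build _ _ _ lebesgue_cons lebesgue_cons_sigma_finite.

End step.

Fixpoint lebesgue_tuple n : {sigma_finite_measure set (n.-tuple T) -> \bar R} :=
  if n is n'.+1 then lebesgue_cons (lebesgue_tuple n')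
  else \d_([tuple] : 0.-tuple T).

Definition row_of_tuple n (t : n.-tuple T) : borel_rV R n :=
  \row_i tnth t i.

Lemma measurable_row_of_tuple n : measurable_fun setT (@row_of_tuple n).
Proof.
refine (@measurability _ _ _ (borel_rV R n) setT _ (@open 'rV[R]_n) erefl _).
move=> _ [U oU <-]; rewrite setTI.
pose c (q : 'rV[rat]_n) : 'rV[R]_n := \row_i ratr (q ord0 i).
pose B (p : 'rV[rat]_n * nat) : set (n.-tuple T) :=
  \bigcap_(i in [set: 'I_n])
    (fun t => tnth t i) @^-1` ball (ratr (p.1 ord0 i) : R) (p.2.+1%:R^-1)%R.
pose S := [set p | ball (c p.1) (p.2.+1%:R^-1 : R)%R `<=` U].
have e0 k : (0 < k.+1%:R^-1 :> R)%R by rewrite invr_gt0 ltr0n.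
have BE p t : B p t <-> ball (c p.1) (p.2.+1%:R^-1 : R)%R (row_of_tuple t).
  split=> [Bt|[_ Bt] i _]; last by have := Bt ord0 i; rewrite !mxE.
  by split=> // i j; rewrite !mxE; exact: Bt.
have -> : @row_of_tuple n @^-1` U =
    \bigcup_(p : 'rV[rat]_n * nat) (if p \in S then B p else set0).
  apply/seteqP; split => [t /= Ut|t [p _]]; last first.
    by case: ifPn => // /set_mem pS /BE /pS.
  have /nbhs_ballP[e /= egt0 eU] : nbhs (row_of_tuple t : 'rV[R]_n) U.
    exact: open_nbhs_nbhs.
  have [k ke] : exists k, (k.+1%:R^-1 + k.+1%:R^-1 <= e :> R)%R.
    have e20 : (0 < e / 2 :> R)%R by rewrite divr_gt0.
    have [k _ /(_ _ (leqnn _))/ltW /= ke] := near_infty_natSinv_lt (PosNum e20).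
    by exists k; apply: (le_trans (lerD ke ke)); rewrite -splitr.
  have q_ i : exists q : rat, ball (ratr q : R) (k.+1%:R^-1)%R (tnth t i).
    have : (tnth t i - k.+1%:R^-1 < tnth t i + k.+1%:R^-1 :> R)%R.
      by rewrite ltrD2l gtrN.
    move=> /rat_in_itvoo[q]; rewrite in_itv/= => /andP[q1 q2]; exists q.
    by rewrite /ball/= ltr_distl q1 q2.
  have {q_}[q qP] := choice q_.
  have Bt : B (\row_i q i, k) t by move=> i _ /=; rewrite mxE; exact: qP.
  exists (\row_i q i, k) => //.
  rewrite ifT//; apply/mem_set => x /= cx; apply: eU; apply: le_ball ke _ _.
  have /BE/ball_sym tc := Bt.
  exact: ball_triangle tc cx.
apply: countable_bigcupT_measurable => // p; case: ifPn => // _.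
apply: fin_bigcap_measurable => // i _.
rewrite -[X in measurable X]setTI; apply: measurable_tnth => //.
rewrite ball_itv; exact: measurable_itv.
Qed.

HB.instance Definition _ n :=
  isMeasurableFun.Build _ _ _ _ (@row_of_tuple n) (@measurable_row_of_tuple n).

Definition lebesgue_rV n : set (borel_rV R n) -> \bar R :=
  pushforward (lebesgue_tuple n) (@row_of_tuple n).

Section measure.
Variable n : nat.

Let lebesgue_rV0 : @lebesgue_rV n set0 = 0.
Proof. exact: measure0. Qed.

Let lebesgue_rV_ge0 A : 0 <= @lebesgue_rV n A.
Proof. exact: measure_ge0. Qed.

Let lebesgue_rV_sigma_additive : semi_sigma_additive (@lebesgue_rV n).
Proof. exact: measure_semi_sigma_additive. Qed.

HB.instance Definition _ := isMeasure.Build _ _ _ (@lebesgue_rV n)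
  lebesgue_rV0 lebesgue_rV_ge0 lebesgue_rV_sigma_additive.

End measure.

End lebesgue_measure_rV.
Arguments lebesgue_rV {R} n _.

(* The norm of 'rV[R]_n is the sup norm: being equivalent to the Euclidean one,
   it yields the same topology, the same locally Lipschitz functions and the
   same limits as |x| tends to infinity. *)
Section defs.
Context {R : realType} {n : nat}.
Implicit Types (Psi f : 'rV[R]_n -> R).

(* Where a partial derivative does not exist, 'D_v f x is a default value; for
   locally Lipschitz f this is a Lebesgue-null set. *)
Definition grad f (x : 'rV[R]_n) : 'rV[R]_n := \row_i 'D_(delta_mx 0 i) f x.

Definition locally_lipschitz f :=
  forall x : 'rV[R]_n, exists2 U, nbhs x U & [lipschitz f y | y in U].

Definition Psi_scaled Psi (p : R) (x : 'rV[R]_n) : R := p^-1 * Psi (p *: x).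

(* When Psi is continuous at 0 with Psi 0 = 0 the set is nonempty, so that inf
   is the genuine infimum. *)
Definition luxemburg Psi (x : 'rV[R]_n) : R :=
  inf [set a | 0 < a /\ Psi (a^-1 *: x) <= 1].

Record condC Psi : Prop := CondC {
  condC_ge0 : forall x, 0 <= Psi x ;
  condC_at0 : Psi 0 = 0 ;
  condC_cont0 : {for 0, continuous Psi} ;
  condC_gt0 : forall x : 'rV[R]_n, x != 0 -> 0 < Psi x ;
  condC_infty : forall M : R, \forall r \near +oo,
    forall x : 'rV[R]_n, r <= `|x| -> M <= Psi x ;
  condC_left : forall (x : 'rV[R]_n) (t : R), 0 < t ->
    Psi (s *: x) @[s --> t^'-] --> Psi (t *: x) ;
  condC_homo : forall x : 'rV[R]_n,
    {in `]0, +oo[ &, {homo (fun t => Psi (t *: x) / t) : s t / s <= t}} ;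
  condC_even : forall x, Psi x = Psi (- x) }.

Definition growth (K alpha beta : R) Psi :=
  forall (x : 'rV[R]_n) (t : R), x != 0 -> 1 <= t ->
    K^-1 * t `^ alpha <= Psi (t *: x) / Psi x <= K * t `^ beta.

Local Open Scope ereal_scope.

(* ln 0 = 0, and 0 * lne 0 = 0 * -oo = 0 in \bar R. *)
Definition Ent (mu : {measure set (borel_rV R n) -> \bar R}) f : \bar R :=
  \int[mu]_x (f x * ln (f x))%:E
  - (\int[mu]_x (f x)%:E) * lne (\int[mu]_x (f x)%:E).

(* Integrals may be +oo, with the convention 0 * +oo = 0. *)
Definition dmLSI (mu : {measure set (borel_rV R n) -> \bar R}) Psi (D d : R) :=
  forall f, (forall x, 0 < f x)%R -> bounded_fun f -> locally_lipschitz f ->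
    Ent mu (fun x => f x ^+ 2)%R <=
      D%:E * \int[mu]_x (Psi ((f x)^-1 *: grad f x) * f x ^+ 2)%:E
      + d%:E * \int[mu]_x (f x ^+ 2)%:E.

End defs.

(* Main.v *)
Require Import Defs.
From HB Require Import structures.
From mathcomp Require Import all_boot all_order all_algebra.
From mathcomp Require Import all_classical all_reals all_analysis.
From mathcomp Require Import measurable_realfun ring lra.
Set Implicit Arguments.
Unset Strict Implicit.
Unset Printing Implicit Defensive.
Import Order.TTheory GRing.Theory Num.Theory.
Import numFieldNormedType.Exports.
Local Open Scope classical_set_scope.
Local Open Scope ring_scope.

(* Let u be the truncation min (max (|f| - t) eps) m and h s = (E u^s)^(1/s).
   Applied to u^(s/2), the inequality bounds Ent u^s / E u^s by
   d + 3/4 p (s/p)^alpha B / h s as long as B <= h s, where B is the constant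
   (K D)^(1/alpha) \/ (K D)^(1/beta) times the p-norm of the gradient: the
   growth condition and Young's inequality give the second term.  By Jensen,
   h s <= h r exp ((1/r - 1/s) Ent u^s / E u^s) for r <= s, and going from beta
   to p in steps of ratio at most 5/4 sums to a geometric series in (s/p)^a with
   a = alpha - 1, hence the factor 1 / (alpha - 1).

   For d <= beta take t = 0; the defect costs a factor exp (d / beta).  For
   d > beta take t just above e^(2d/beta) times the beta-norm of f: then u exceeds
   eps only on a set of measure at most e^(-2d), so Ent u^s is at least about
   (2d - 1) E u^s, which absorbs the defect; t itself yields the first term of
   the conclusion.  Then eps tends to 0 and m to infinity.

   Rademacher's theorem is avoided: the chain rule for u^(s/2) holds at every
   point for default partial derivatives as well. *)

(** * Integrals of nonnegative functions that may fail to be measurable *)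

Section lower_integral.
Context d (T : measurableType d) (R : realType).
Variable mu : {measure set T -> \bar R}.
Import HBNNSimple.
Local Open Scope ereal_scope.

(** The integral of a nonnegative function is a supremum over the simple functions below it, hence
    monotone without measurability. *)
Lemma ge0_le_integral_nonmeas (f g : T -> \bar R) :
  (forall x, 0 <= f x) -> (forall x, f x <= g x) ->
  \int[mu]_x f x <= \int[mu]_x g x.
Proof.
move=> f0 fg; have g0 x : 0 <= g x by exact: le_trans (f0 x) (fg x).
rewrite !ge0_integralTE//; apply: le_ereal_sup => _ [h hf <-].
by exists h => // x; exact: le_trans (hf x) (fg x).
Qed.

(* [Phi] and [X] need not be measurable: their integrals are then lower
   integrals, still additive when one summand, here [g], is measurable. *)
Lemma integral_le_add_nonmeas (D a : R) (Phi X g : T -> R) :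
  (0 <= D)%R -> (0 <= a)%R -> (forall x, 0 <= Phi x)%R ->
  (forall x, 0 <= X x)%R -> (forall x, 0 <= g x)%R ->
  measurable_fun setT g ->
  (forall x, D * Phi x <= a * X x + g x)%R ->
  D%:E * \int[mu]_x (Phi x)%:E <=
    a%:E * \int[mu]_x (X x)%:E + \int[mu]_x (g x)%:E.
Proof.
move=> D0 a0 Phi0 X0 g0 mg le.
have [->|Dn0] := eqVneq D 0%R.
  rewrite mul0e adde_ge0// ?mule_ge0 ?lee_fin//;
    by apply: integral_ge0 => x _; rewrite lee_fin.
have Dgt0 : (0 < D)%R by rewrite lt_neqAle eq_sym Dn0.
rewrite -lee_pdivlMl//.
rewrite [leLHS]ge0_integralTE; last by move=> x; rewrite lee_fin.
apply: ge_ereal_sup => _ [h hPhi <-].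
rewrite lee_pdivlMl// -sintegralrM.
(* [psi] is measurable, lies below [a * X], and [psi + g] dominates [D * h]; additivity is then
   applied to measurable functions only. *)
pose psi x := Num.max 0%R (D * h x - g x)%R.
have mDh : measurable_fun setT (fun x => D * h x)%R by exact: measurable_funM.
have mpsi : measurable_fun setT psi.
  by apply: measurable_maxr => //; exact: measurable_funB.
have psiX x : (psi x <= a * X x)%R.
  rewrite /psi ge_max mulr_ge0//= lerBlDr (le_trans _ (le x))//.
  by rewrite ler_wpM2l// -lee_fin; exact: hPhi.
have -> : sintegral mu (cst D \* h)%R = \int[mu]_x (D * h x)%:E.
  rewrite (_ : (cst D \* h)%R = scale_nnsfun h D0) //.
  by rewrite -[in LHS](@patch_setT _ _ (cst 0%R) (scale_nnsfun h D0)) -integral_nnsfun.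
apply: (@le_trans _ _ (\int[mu]_x ((psi x)%:E + (g x)%:E))).
  apply: ge0_le_integral_nonmeas => x; first by rewrite lee_fin mulr_ge0.
  by rewrite -EFinD lee_fin -lerBlDr /psi le_max lexx orbT.
rewrite ge0_integralD//; last 4 first.
- by move=> x _; rewrite lee_fin /psi le_max lexx.
- exact/measurable_EFinP.
- by move=> x _; rewrite lee_fin.
- exact/measurable_EFinP.
rewrite leeD2r//.
have [a00|an0] := eqVneq a 0%R.
  rewrite a00 mul0e integral0_eq// => x _; congr EFin; apply/eqP.
  have := psiX x; rewrite a00 mul0r eq_le => ->.
  by rewrite /psi le_max lexx.
have agt0 : (0 < a)%R by rewrite lt_neqAle eq_sym an0.
have -> : \int[mu]_x (psi x)%:E = a%:E * \int[mu]_x (a^-1 * psi x)%:E.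
  under [in RHS]eq_integral do rewrite EFinM.
  rewrite ge0_integralZl//; last 3 first.
  - exact/measurable_EFinP.
  - by move=> x _; rewrite lee_fin /psi le_max lexx.
  - by rewrite lee_fin invr_ge0.
  by rewrite muleA -EFinM divff// mul1e.
apply: lee_wpmul2l; first by rewrite lee_fin.
apply: ge0_le_integral_nonmeas => x; rewrite lee_fin.
  by rewrite mulr_ge0 ?invr_ge0// /psi le_max lexx.
by rewrite ler_pdivrMl.
Qed.

End lower_integral.

(** * Inequalities for exponentials and powers; the moment recursion *)

Section real_inequalities.
Context {R : realType}.
Implicit Types a b p q r s t u v x y z : R.

(** The exponential lies above its tangent at [z]; the remaining weight [1 - a - b] is put on the
    point 0. *)
Lemma expR_convex3 a b x y : 0 <= a -> 0 <= b -> a + b <= 1 ->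
  expR (a * x + b * y) <= a * expR x + b * expR y + (1 - a - b).
Proof.
move=> a0 b0 ab; set z := a * x + b * y.
have tangent w : expR z * (1 + (w - z)) <= expR w.
  have -> : expR w = expR z * expR (w - z) by rewrite -expRD; congr expR; ring.
  by rewrite ler_wpM2l ?expR_ge0// expR_ge1Dx.
have c0 : 0 <= 1 - a - b by lra.
have := lerD (lerD (ler_wpM2l a0 (tangent x)) (ler_wpM2l b0 (tangent y)))
  (ler_wpM2l c0 (tangent 0)).
rewrite expR0 mulr1; apply: le_trans.
rewrite le_eqVlt; apply/orP; left; apply/eqP.
rewrite /z; ring.
Qed.

Lemma powRE x a : 0 < x -> x `^ a = expR (a * ln x).
Proof. by move=> x0; rewrite /powR gt_eqF. Qed.

Lemma powRV x a : 0 < x -> x^-1 `^ a = (x `^ a)^-1.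
Proof. by move=> x0; rewrite !powRE ?invr_gt0// lnV ?posrE// mulrN expRN. Qed.

Lemma powR_le_bernoulli x a : 0 < x -> 0 <= a -> a <= 1 ->
  x `^ a <= 1 + a * (x - 1).
Proof.
move=> x0 a0 a1.
have := @expR_convex3 a 0 (ln x) 0 a0 (lexx 0).
rewrite powRE// lnK ?posrE// addr0 !mul0r !addr0 => /(_ a1) h; lra.
Qed.

Lemma powR_ge_bernoulli x a : 0 < x -> 1 <= a -> 1 + a * (x - 1) <= x `^ a.
Proof.
move=> x0 a1; have a0 : 0 < a by lra.
have := @powR_le_bernoulli (x `^ a) a^-1 (powR_gt0 a x0).
rewrite invr_ge0 (ltW a0) invf_le1// a1 -powRrM divff ?gt_eqF// powRr1 ?(ltW x0)//.
move=> /(_ isT isT); rewrite -(ler_pM2l a0) mulrDr mulr1 mulVKf ?gt_eqF//; lra.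
Qed.

(** This is the tangent of [x * ln x] at [y], in the form that bounds entropies from below. *)
Lemma ln_ge_1Binv x y : 0 < x -> 0 < y -> x - y <= x * ln (x / y).
Proof.
move=> x0 y0; have yx : 0 < y / x by rewrite divr_gt0.
have := @le_ln1Dx R (y / x - 1); rewrite [1 + _]addrC subrK => h.
have {h} : ln (y / x) <= y / x - 1 by apply: h; lra.
rewrite -[x / y]invf_div lnV ?posrE// -(ler_pM2l x0) mulrBr mulr1.
by rewrite mulrCA divff ?gt_eqF// mulr1; lra.
Qed.

(** The inequality is linear in the logarithms. It is meant for [x] and [y] the moments of orders
    [s] and [r], and [e] the entropy divided by [x]. *)
Lemma powR_le_of_expR_le x y e r s : 0 < x -> 0 < y -> 0 < r -> 0 < s ->
  expR (- ((s - r) / s * (e + ln x))) * x <= y ->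
  x `^ s^-1 <= y `^ r^-1 * expR ((r^-1 - s^-1) * e).
Proof.
move=> x0 y0 r0 s0; set k := (s - r) / s => h.
have {}h : - (k * (e + ln x)) + ln x <= ln y.
  rewrite -[X in X + _]expRK -lnM ?posrE ?expR_gt0//.
  by rewrite ler_ln ?posrE ?mulr_gt0 ?expR_gt0.
rewrite !powRE// -expRD ler_expR -(ler_pM2l r0).
have -> : r * (s^-1 * ln x) =
    - (k * (e + ln x)) + ln x + r * ((r^-1 - s^-1) * e).
  by rewrite /k; field; rewrite !gt_eqF.
by rewrite [leRHS]mulrDr [r * (r^-1 * _)]mulrA divff ?gt_eqF// mul1r lerD2r.
Qed.

(* One step of the recursion shrinks [s] by a factor at most [q]; the invariant
   absorbs the geometric series of the error terms. *)
Lemma moment_recursion (h : R -> R) (beta p B d lam a q : R) :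
  0 < a -> a <= 1 -> 1 < q -> 1 <= beta -> beta <= p ->
  0 < B -> 0 <= d -> 0 <= lam ->
  (forall r s, beta <= r -> r <= s -> s <= q * r -> s <= p -> B <= h s ->
    h s <= h r *
      expR ((r^-1 - s^-1) * (d + lam * p * (s / p) `^ (1 + a) * (B / h s)))) ->
  h p <= expR (d / beta) * (Num.max (h beta) B + lam * (q / a) * B).
Proof.
move=> a0 a1 q1 beta1 betap B0 d0 lam0 step.
have beta0 : 0 < beta by lra.
have p0 : 0 < p by lra.
have q0 : 0 < q by lra.
(* The invariant: the exponential collects the defect, the power of [s / p] the errors made up to
   [s]. *)
pose bnd s := expR (d * (beta^-1 - s^-1)) *
  (Num.max (h beta) B + lam * (q / a) * (s / p) `^ a * B).
have B_bnd s : beta <= s -> B <= bnd s.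
  move=> bs; have s0 : 0 < s by lra.
  have e1 : 1 <= expR (d * (beta^-1 - s^-1)).
    by rewrite -expR0 ler_expR mulr_ge0// subr_ge0 lef_pV2// posrE.
  have m1 : B <= Num.max (h beta) B + lam * (q / a) * (s / p) `^ a * B.
    apply: (@le_trans _ _ (Num.max (h beta) B)); first by rewrite le_max lexx orbT.
    by rewrite lerDl !mulr_ge0 ?powR_ge0 ?invr_ge0//; exact: ltW.
  by rewrite -[B]mul1r /bnd ler_pM// ltW.
have beta_bnd : h beta <= bnd beta.
  rewrite /bnd subrr mulr0 expR0 mul1r.
  apply: (@le_trans _ _ (Num.max (h beta) B)); first by rewrite le_max lexx.
  by rewrite lerDl !mulr_ge0 ?powR_ge0 ?invr_ge0//; exact: ltW.
(* Induction on the number of steps of ratio [q] from [beta] to [s]. Where [h s < B] the claim is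
   immediate, since [B] is below the invariant. *)
have main k s : beta <= s -> s <= p -> s <= beta * q ^+ k -> h s <= bnd s.
  elim: k s => [|k IH] s bs sp; first rewrite expr0 mulr1 => sb.
    by have -> : s = beta by lra.
  rewrite exprS => sk.
  have s0 : 0 < s by lra.
  have [hB|Bh] := ltP (h s) B; first exact: le_trans (ltW hB) (B_bnd s bs).
  pose r := Num.max beta (s / q).
  have br : beta <= r by rewrite /r le_max lexx.
  have r0 : 0 < r by lra.
  have rs : r <= s.
    by rewrite /r ge_max bs/= ler_pdivrMr// ler_peMr ?(ltW s0)// ltW.
  have sqr : s <= q * r.
    rewrite -ler_pdivrMl// mulrC /r le_max; by rewrite lexx orbT.
  have IHr : h r <= bnd r.
    apply: IH => //; first exact: le_trans rs sp.
    rewrite /r ge_max; apply/andP; split.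
      by rewrite ler_peMr ?(ltW beta0)//; exact: exprn_ege1 (ltW q1).
    by rewrite ler_pdivrMr// -mulrA [_ ^+ k * q]mulrC.
  have hs0 : 0 < h s by lra.
  pose delta := r^-1 - s^-1.
  have delta0 : 0 <= delta by rewrite subr_ge0 lef_pV2// posrE.
  pose z := delta * (lam * p * (s / p) `^ (1 + a) * B).
  have spE : (s / p) `^ (1 + a) = (s / p) * (s / p) `^ a.
    rewrite powRD; last by apply/implyP => _; rewrite gt_eqF// divr_gt0.
    by rewrite powRr1// ltW// divr_gt0.
  have zE : z = lam * (s / r - 1) * (s / p) `^ a * B.
    rewrite /z /delta spE; field.
    by rewrite !gt_eqF.
  (* The bound [1 - y <= expR (- y)] at [y = z / h s] turns the multiplicative error into the
     additive error [z], which is free of [h s]. *)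
  have hz : h s <= h r * expR (d * delta) + z.
    have := step r s br rs sqr sp Bh.
    have -> : (r^-1 - s^-1) * (d + lam * p * (s / p) `^ (1 + a) * (B / h s)) =
        d * delta + z / h s.
      by rewrite /z /delta; ring.
    rewrite expRD mulrA => st.
    have : h s * expR (- (z / h s)) <= h r * expR (d * delta).
      by rewrite expRN ler_pdivrMr ?expR_gt0.
    move=> le.
    apply: (@le_trans _ _ (h s * expR (- (z / h s)) + z)); last first.
      by rewrite lerD2r.
    have := ler_wpM2l (ltW hs0) (expR_ge1Dx (- (z / h s))).
    by rewrite mulrDr mulr1 mulrN mulrCA divff ?gt_eqF// mulr1; lra.
  pose E := expR (d * (beta^-1 - s^-1)).
  have E1 : 1 <= E.
    by rewrite -expR0 ler_expR mulr_ge0// subr_ge0 lef_pV2// posrE.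
  pose w := r / s.
  have w0 : 0 < w by rewrite divr_gt0.
  have w1 : w <= 1 by rewrite ler_pdivrMr// mul1r.
  have wq : w^-1 <= q by rewrite invf_div ler_pdivrMr.
  (* One term of the geometric series: by concavity the power of [w] is at most [1 - a * (1 - w)];
     after multiplication by [q / a] the gain [q * (1 - w)] outweighs [w^-1 - 1]. *)
  have key : (q / a) * w `^ a + (w^-1 - 1) <= q / a.
    have := powR_le_bernoulli w0 (ltW a0) a1.
    move=> /(ler_wpM2l (ltW (divr_gt0 q0 a0))) h1.
    have h2 : (q / a) * (1 + a * (w - 1)) = q / a + q * (w - 1).
      by field; rewrite gt_eqF.
    have h3 : (w^-1 - 1) <= q * (1 - w).
      have -> : w^-1 - 1 = w^-1 * (1 - w) by field; rewrite gt_eqF.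
      by rewrite ler_wpM2r// subr_ge0.
    lra.
  have rpE : (r / p) `^ a = w `^ a * (s / p) `^ a.
    rewrite -powRM ?(ltW w0)//; last by rewrite ltW// divr_gt0.
    congr powR; rewrite /w; field.
    by rewrite !gt_eqF.
  have z0 : 0 <= z.
    rewrite zE !mulr_ge0 ?powR_ge0 ?(ltW B0)//.
    by rewrite subr_ge0 ler_pdivlMr// mul1r.
  apply: (le_trans hz).
  have h1 : h r * expR (d * delta) <= bnd r * expR (d * delta).
    by rewrite ler_wpM2r ?expR_ge0.
  have EE : bnd r * expR (d * delta) = E *
      (Num.max (h beta) B + lam * (q / a) * (r / p) `^ a * B).
    rewrite /bnd mulrAC -expRD; congr (_ * _); congr expR.
    by rewrite /delta; ring.
  have zEE : z <= E * z by rewrite ler_peMl.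
  apply: (@le_trans _ _ (E * (Num.max (h beta) B
      + lam * (q / a) * (r / p) `^ a * B + z))).
    by rewrite [E * _]mulrDr -EE; lra.
  rewrite /bnd -/E ler_wpM2l ?expR_ge0// -addrA lerD2l zE rpE.
  have -> : s / r = w^-1 by rewrite invf_div.
  have -> : lam * (q / a) * (w `^ a * (s / p) `^ a) * B +
      lam * (w^-1 - 1) * (s / p) `^ a * B =
    ((q / a) * w `^ a + (w^-1 - 1)) * (lam * (s / p) `^ a * B) by ring.
  have -> : lam * (q / a) * (s / p) `^ a * B =
    (q / a) * (lam * (s / p) `^ a * B) by ring.
  by rewrite ler_wpM2r// !mulr_ge0 ?powR_ge0 ?(ltW B0).
have [k pk] : exists k, p <= beta * q ^+ k.
  have lnq : 0 < ln q by rewrite ln_gt0.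
  have := archi_boundP (ltW (divr_gt0 p0 lnq)).
  move: (Num.bound _) => N; rewrite ltr_pdivrMr// => pb; exists N.
  have e : p <= q ^+ N.
    rewrite -[q](@lnK _ q) ?posrE// -expRM_natl.
    apply: le_trans (expR_ge1Dx _).
    by rewrite (le_trans (ltW pb))// ltW// ltrDr.
  by apply: (le_trans e); rewrite ler_peMl// exprn_ge0// ltW.
apply: (le_trans (main k p betap (lexx p) pk)).
rewrite /bnd divff ?gt_eqF// powR1 mulr1 ler_wpM2r//.
  rewrite addr_ge0//; first by rewrite le_max (ltW B0) orbT.
  by rewrite !mulr_ge0 ?invr_ge0 ?(ltW q0) ?(ltW a0) ?(ltW B0).
rewrite ler_expR ler_wpM2l// lerBlDr lerDl invr_ge0; exact: ltW.
Qed.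

End real_inequalities.

(* Weighted AM-GM with weights [g / p], [1 - g / s], [g / s - g / p] applied to
   [(N / A) ^ p], [(u / h) ^ s] and 1. *)
Lemma young_moment {R : realType} (g s p N u A h B kappa : R) :
  0 < g -> g <= s -> s <= p -> 0 <= N -> 0 < u -> 0 < A -> 0 < h -> 0 < B ->
  0 <= kappa -> kappa <= (B / A) `^ g ->
  kappa * (N / (2 * u)) `^ g * u `^ s <=
    (B / (2 * h)) `^ g * h `^ s *
      (g / p * (N / A) `^ p + (1 - g / s) * (u / h) `^ s + (g / s - g / p)).
Proof.
move=> g0 gs sp N0 u0 A0 h0 B0 k0 kle.
have s0 : 0 < s by lra.
have p0 : 0 < p by lra.
have gp1 : g / p <= g / s by rewrite ler_wpM2l ?(ltW g0)// lef_pV2 ?posrE.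
have gs1 : g / s <= 1 by rewrite ler_pdivrMr// mul1r.
have gs0 : 0 <= g / s by rewrite divr_ge0// ltW.
have gp0 : 0 <= g / p by rewrite divr_ge0// ltW.
have R0 : 0 <= (B / (2 * h)) `^ g * h `^ s by rewrite mulr_ge0 ?powR_ge0.
have [N00|Nn0] := eqVneq N 0.
  rewrite N00 !mul0r (@powR0 _ g) ?gt_eqF// !(mulr0,mul0r) mulr_ge0//.
  have a1 := powR_ge0 (0 : R) p; have a2 := powR_ge0 (u / h) s.
  by rewrite addr_ge0 ?subr_ge0// addr_ge0// mulr_ge0// subr_ge0.
have Ngt0 : 0 < N by rewrite lt_neqAle eq_sym Nn0.
have h20 : 0 < 2 * h by rewrite mulr_gt0.
have u20 : 0 < 2 * u by rewrite mulr_gt0.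
apply: (@le_trans _ _ ((B / A) `^ g * (N / (2 * u)) `^ g * u `^ s)).
  by rewrite -!mulrA ler_wpM2r// mulr_ge0 ?powR_ge0.
have -> : (B / A) `^ g * (N / (2 * u)) `^ g * u `^ s =
   (B / (2 * h)) `^ g * h `^ s *
     expR ((g / p) * (p * ln (N / A)) + (1 - g / s) * (s * ln (u / h))).
  rewrite !powRE ?divr_gt0// -!expRD; congr expR.
  rewrite !ln_div ?posrE// !lnM ?posrE//; field.
  by rewrite !gt_eqF.
rewrite ler_wpM2l// (le_trans (expR_convex3 _ _ _ _ _))//; try lra.
by rewrite -!powRE ?divr_gt0//; lra.
Qed.

(** * Entropy of functions bounded between positive constants *)

Section entropy.
Context d (T : measurableType d) (R : realType).
Variable mu : probability T R.

Lemma integrable_bounded (f : T -> R) (c : R) :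
  measurable_fun setT f -> (forall x, `|f x| <= c) ->
  mu.-integrable setT (EFin \o f).
Proof.
move=> mf fc; apply: measurable_bounded_integrable => //.
  by have := probability_setT mu; move=> /= ->; rewrite ltry.
exists c; split; first by rewrite realE; case: (lerP 0 c) => // /ltW ->.
by move=> M cM x _; apply: le_trans (fc x) (ltW cM).
Qed.

Lemma integrable_mul_ln (F : T -> R) (c C : R) :
  measurable_fun setT F -> 0 < c -> (forall x, c <= F x <= C) ->
  mu.-integrable setT (EFin \o (fun x => F x * ln (F x))).
Proof.
move=> mF c0 cFC.
apply: (@integrable_bounded _ (C * (`|ln c| + `|ln C|))).
  apply: measurable_funM => //.
  exact: measurableT_comp (@measurable_ln R) mF.
move=> x; have /andP[cF FC] := cFC x.
have F0 : 0 < F x by exact: lt_le_trans cF.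
rewrite normrM gtr0_norm// ler_pM ?normr_ge0//; first exact: ltW.
have l1 : ln c <= ln (F x) by rewrite ler_ln ?posrE.
have l2 : ln (F x) <= ln C by rewrite ler_ln ?posrE//; exact: lt_le_trans FC.
rewrite ler_norml; apply/andP; split.
  have := ler_norm (- ln c); rewrite normrN; have := normr_ge0 (ln C); lra.
have := ler_norm (ln C); have := normr_ge0 (ln c); lra.
Qed.

Let int_cst (k : R) : mu.-integrable setT (EFin \o (fun=> k)).
Proof. exact: (@integrable_bounded _ `|k|). Qed.

Let intZ (k : R) (f : T -> R) : mu.-integrable setT (EFin \o f) ->
  mu.-integrable setT (EFin \o (fun x => k * f x)).
Proof.
by move=> fi; rewrite (_ : _ \o _ = fun x => (k%:E * (EFin \o f) x)%E)//;
  exact: integrableZl.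
Qed.

Let intD (f g : T -> R) : mu.-integrable setT (EFin \o f) ->
  mu.-integrable setT (EFin \o g) ->
  mu.-integrable setT (EFin \o (fun x => f x + g x)).
Proof.
by move=> fi gi; rewrite (_ : _ \o _ = (EFin \o f) \+ (EFin \o g))%E//;
  exact: integrableD.
Qed.


Definition entropy (F : T -> R) : R :=
  \int[mu]_x (F x * ln (F x)) - (\int[mu]_x F x) * ln (\int[mu]_x F x).

Lemma Rintegral_probability_cst (c : R) : \int[mu]_x (fun=> c) x = c.
Proof.
by rewrite Rintegral_cst//; have /= -> := probability_setT mu; rewrite mulr1.
Qed.

Lemma Rintegral_gt0 (f : T -> R) (c : R) : 0 < c ->
  mu.-integrable setT (EFin \o f) -> (forall x, c <= f x) ->
  0 < \int[mu]_x f x.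
Proof.
move=> c0 fi cf; apply: (lt_le_trans c0).
rewrite -{1}(Rintegral_probability_cst c).
by apply: le_Rintegral.
Qed.

(* With [M] the [s]-th moment, the average of [ln (u^s)] for the density
   [u^s / M] is [entropy (u^s) / M + ln M]; the bound is Jensen's inequality for
   the exponential. *)
Lemma moment_le_entropy (u : T -> R) (c C r s : R) :
  measurable_fun setT u -> 0 < c -> (forall x, c <= u x <= C) ->
  0 < r -> r <= s ->
  (\int[mu]_x (u x `^ s)) `^ s^-1 <= (\int[mu]_x (u x `^ r)) `^ r^-1 *
    expR ((r^-1 - s^-1) *
      (entropy (fun x => u x `^ s) / \int[mu]_x (u x `^ s))).
Proof.
move=> mu_ c0 cuC r0 rs.
set M := \int[mu]_x (u x `^ s); set e := (_ / M).
have s0 : 0 < s by lra.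
have u0 x : 0 < u x by have /andP[+ _] := cuC x; exact: lt_le_trans.
have C0 : 0 < C by case/andP: (cuC point) => h1 h2; apply: lt_le_trans h2; exact: lt_le_trans h1.
have bnd a : 0 < a -> forall x, c `^ a <= u x `^ a <= C `^ a.
  move=> a0 x; have /andP[h1 h2] := cuC x.
  by rewrite !ge0_ler_powR ?nnegrE ?(ltW a0) ?(ltW c0) ?(ltW (u0 x)) ?(ltW C0).
have mpow a : measurable_fun setT (fun x => u x `^ a).
  exact: (measurableT_comp (@measurable_powR R a)).
have ipow a : 0 < a -> mu.-integrable setT (EFin \o (fun x => u x `^ a)).
  move=> a0; apply: (@integrable_bounded _ (C `^ a)) => // x.
  by rewrite ger0_norm ?powR_ge0//; case/andP: (bnd a a0 x).
have iF := ipow s s0.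
have iFl := integrable_mul_ln (mpow s) (powR_gt0 s c0) (bnd s s0).
have M0 : 0 < M.
  apply: (Rintegral_gt0 (powR_gt0 s c0) iF) => x.
  by case/andP: (bnd s s0 x).
have Mr0 : 0 < \int[mu]_x (u x `^ r).
  apply: (Rintegral_gt0 (powR_gt0 r c0) (ipow r r0)) => x.
  by case/andP: (bnd r r0 x).
pose I := \int[mu]_x (u x `^ s * ln (u x `^ s)).
pose b := e + ln M.
have bM : b * M = I by rewrite /b /e /entropy -/M -/I; field; rewrite gt_eqF.
pose k := (s - r) / s.
(* Tangent of the exponential at 0, with [k] times the deviation of the logarithm from its average
   [b] as argument. Integrated against the power of order [s], the deviation vanishes by [bM]. *)
have pointwise x :
    expR (- (k * b)) * ((1 + k * b) * u x `^ s + - k * (u x `^ s * ln (u x `^ s)))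
      <= u x `^ r.
  have -> : u x `^ r = u x `^ s * (expR (- (k * b)) * expR (k * (b - ln (u x `^ s)))).
    rewrite -expRD !powRE// -expRD expRK; congr expR.
    by rewrite /k; field; rewrite gt_eqF.
  have -> : (1 + k * b) * u x `^ s + - k * (u x `^ s * ln (u x `^ s)) =
     u x `^ s * (1 + k * (b - ln (u x `^ s))) by ring.
  rewrite mulrCA ler_wpM2l ?powR_ge0// ler_wpM2l ?expR_ge0//.
  exact: expR_ge1Dx.
have : expR (- (k * b)) * M <= \int[mu]_x (u x `^ r).
  apply: le_trans (le_Rintegral measurableT _ (ipow r r0) (fun x _ => pointwise x)).
    rewrite RintegralZl//; last by apply: intD; exact: intZ.
    rewrite RintegralD//; [|exact: intZ|exact: intZ].
    rewrite !RintegralZl// -/M -/I -bM ler_wpM2l ?expR_ge0//.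
    by rewrite le_eqVlt; apply/orP; left; apply/eqP; ring.
  by apply: intZ; apply: intD; exact: intZ.
by rewrite /k /b => /(powR_le_of_expR_le M0 Mr0 r0 s0).
Qed.

(* [1 <= G] on the set where [F] exceeds its minimum [tau]; by Markov's
   inequality this set is small, which forces a large entropy. *)
Lemma entropy_ge (F G : T -> R) (tau C a : R) :
  measurable_fun setT F -> 0 < tau -> (forall x, tau <= F x <= C) -> 0 <= a ->
  mu.-integrable setT (EFin \o G) -> (forall x, 0 <= G x) ->
  \int[mu]_x G x <= expR (- a) -> (forall x, F x = tau \/ 1 <= G x) ->
  (a - 1) * \int[mu]_x F x - a * tau <= entropy F.
Proof.
move=> mF tau0 FC a0 iG G0 Ga FG.
rewrite /entropy; set M := \int[mu]_x F x.
have F0 x : 0 < F x by have /andP[+ _] := FC x; exact: lt_le_trans.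
have iF : mu.-integrable setT (EFin \o F).
  apply: (@integrable_bounded _ C) => // x.
  by rewrite gtr0_norm//; case/andP: (FC x).
have iFl := integrable_mul_ln mF tau0 FC.
have M0 : 0 < M by apply: (Rintegral_gt0 tau0 iF) => x; case/andP: (FC x).
have ea : 1 <= expR a by rewrite -expR0 ler_expR.
(* [F * ln F] lies above its tangent at [M], used where [F = tau], and above its tangent at
   [M * expR a], used where [1 <= G]. The terms in [tau] and [G] merge both cases into one
   integrable bound. *)
have pointwise x : (a + 1 + ln M) * F x + ((- (a * tau) - M) + - (M * (expR a - 1)) * G x)
    <= F x * ln (F x).
  have [Fx|G1] := FG x.
    have := ln_ge_1Binv (F0 x) M0; rewrite ln_div ?posrE// mulrBr.
    have : 0 <= M * (expR a - 1) * G x by rewrite !mulr_ge0 ?(ltW M0)// subr_ge0.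
    by rewrite Fx; lra.
  have Me : 0 < M * expR a by rewrite mulr_gt0 ?expR_gt0.
  have := ln_ge_1Binv (F0 x) Me; rewrite ln_div ?posrE// lnM ?posrE ?expR_gt0//.
  rewrite expRK !(mulrBr, mulrDr).
  have : 0 <= M * (expR a - 1) * (G x - 1).
    by rewrite !mulr_ge0 ?(ltW M0)// subr_ge0.
  have : 0 <= a * tau by rewrite mulr_ge0// ltW.
  rewrite !(mulrBr, mulrBl); lra.
have := le_Rintegral measurableT _ iFl (fun x _ => pointwise x).
rewrite RintegralD//; [|exact: intZ|by apply: intD => //; exact: intZ].
rewrite RintegralD//; [|exact: intZ].
rewrite !RintegralZl// Rintegral_probability_cst -/M => h.
have {h} := h (intD (intZ _ iF) (intD (int_cst _) (intZ _ iG))).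
have : M * (expR a - 1) * \int[mu]_x G x <= M.
  apply: (@le_trans _ _ (M * (expR a - 1) * expR (- a))).
    by rewrite ler_wpM2l// mulr_ge0 ?(ltW M0)// subr_ge0.
  rewrite -mulrA ler_piMr ?(ltW M0)// mulrBl -expRD subrr expR0 mul1r.
  by rewrite lerBlDr lerDl expR_ge0.
rewrite mulNr !mulrDl; lra.
Qed.

End entropy.

(** * Directional derivatives, default values included *)

Section derivative_defaults.
Context {R : realType} {V : normedModType R}.

Lemma derive_dvg (f : V -> R) (x v : V) : ~ derivable f x v -> 'D_v f x = 0.
Proof. by move=> /dvgP. Qed.

(* Holds also where [f] has no derivative: as [c != 0], the difference
   quotients of [phi \o f] and of [f] converge together, so that both sides
   are the default value 0 when they do not. *)
Lemma derive_comp_default (phi : R -> R) (f : V -> R) (x v : V) (c : R) :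
  f (h *: v + x) @[h --> (0 : R)] --> f x ->
  is_derive (f x) 1 phi c -> c != 0 ->
  'D_v (phi \o f) x = c * 'D_v f x.
Proof.
move=> fc [phid phiE] c0; set y0 := f x.
(* Caratheodory's slope function, continuous at [y0]: [Qg] is its value times [Qf] even where the
   increment of [f] is zero. *)
pose q y := if y == y0 then c else (phi y - phi y0) / (y - y0).
have qc : q y @[y --> y0] --> c.
  have : h^-1 *: (phi (h *: (1:R) + y0) - phi y0) @[h --> 0^'] --> c.
    by rewrite -phiE; exact: phid.
  move=> /cvgrPdist_lt hc; apply/cvgrPdist_lt => e e0.
  have /nbhs_ballP[r /= r0 hr] := hc e e0.
  apply/nbhs_ballP; exists r => //= y; rewrite /ball/= => yr.
  rewrite /q; have [_|yn] := eqVneq y y0; first by rewrite subrr normr0.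
  have := hr (y - y0); rewrite /ball/= sub0r normrN -normrN opprB => /(_ yr).
  rewrite subr_eq0 => /(_ yn).
  by rewrite -[_ *: (1:R)]/(_ * 1) mulr1 subrK -[_ *: _]/(_ * _) mulrC.
pose Qf (h : R) := h^-1 *: ((f \o shift x) (h *: v) - f x).
pose Qg (h : R) := h^-1 *: ((phi \o f \o shift x) (h *: v) - (phi \o f) x).
have fc' : f (h *: v + x) @[h --> 0^'] --> f x.
  by apply: cvg_trans fc; apply: cvg_app; exact: nbhs_dnbhs.
have qfc : q (f (h *: v + x)) @[h --> 0^'] --> c by exact: (cvg_comp _ _ fc' qc).
have QE h : Qg h = q (f (h *: v + x)) * Qf h.
  rewrite /Qg /Qf /q /=; have [->|yn] := eqVneq.
    by rewrite !subrr !scaler0 mulr0.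
  rewrite -/y0 -![_ *: _]/(_ * _).
  by rewrite mulrCA divfK// subr_eq0.
have [df|ndf] := pselect (derivable f x v).
  apply: cvg_lim => //; rewrite (_ : (fun _ => _) = fun h => q (f (h *: v + x)) * Qf h).
    exact: cvgM qfc df.
  by apply/funext => h; rewrite -QE.
have -> : 'D_v f x = 0 by exact: derive_dvg.
rewrite mulr0; apply: derive_dvg => dg; apply: ndf.
have : (q (f (h *: v + x)))^-1 * Qg h @[h --> 0^'] --> c^-1 * 'D_v (phi \o f) x.
  apply: cvgM; last exact: dg.
  exact: cvgV qfc.
move=> hc; apply/cvg_ex; exists (c^-1 * 'D_v (phi \o f) x).
apply: cvg_trans hc; apply: near_eq_cvg.
have : \forall h \near (0:R)^', q (f (h *: v + x)) != 0.
  have /cvgrPdist_lt/(_ `|c|) := qfc; rewrite normr_gt0 => /(_ c0).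
  apply: filterS => h; apply: contraTneq => ->; by rewrite subr0 ltxx.
by apply: filterS => h qh; rewrite QE mulKf.
Qed.

(** Difference quotients at [h] and [- h] have opposite signs, so an existing derivative vanishes; a
    missing one is 0 by default. *)
Lemma derive_min (f : V -> R) (x v : V) :
  (forall y, f x <= f y) -> 'D_v f x = 0.
Proof.
move=> fm; have [df|/derive_dvg//] := pselect (derivable f x v).
have sgn (h : R) : 0 <= h * (h^-1 *: ((f \o shift x) (h *: v) - f x)).
  have [->|h0] := eqVneq h 0; first by rewrite mul0r lexx.
  rewrite -[_ *: _]/(_ * _) mulrA divff// mul1r subr_ge0; exact: fm.
set l := 'D_v f x; apply/eqP; apply: contrapT => /negP/eqP l0.
have nl : 0 < `|l| by rewrite normr_gt0; exact/eqP.
have /cvgrPdist_lt/(_ _ nl)/nbhs_ballP[r /= r0 hr] := df.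
have r2 : 0 < r / 2 by rewrite divr_gt0.
have bl (h : R) : `|h| = r / 2 -> `|l - h^-1 *: ((f \o shift x) (h *: v) - f x)| < `|l|.
  move=> hE; apply: hr; last by rewrite -normr_gt0 hE.
  by rewrite /ball/= sub0r normrN hE ltr_pdivrMr// ltr_pMr// ltr1n.
have := bl (r / 2) (gtr0_norm r2); have := sgn (r / 2).
rewrite pmulr_rge0// => s1; move: s1; set a := _ *: _ => s1.
have := bl (- (r / 2)); rewrite normrN => /(_ (gtr0_norm r2)); have := sgn (- (r / 2)).
rewrite mulNr oppr_ge0 pmulr_rle0//; set b := _ *: _ => s2.
have [lp|ln] := ltP l 0.
  rewrite (ltr0_norm lp) => _; rewrite ltr_norml => /andP[]; lra.
have lp : 0 < l by lra.
rewrite (gtr0_norm lp) ltr_norml => /andP[]; lra.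
Qed.

Lemma derive_max (f : V -> R) (x v : V) :
  (forall y, f y <= f x) -> 'D_v f x = 0.
Proof.
move=> fm; have [df|/derive_dvg//] := pselect (derivable f x v).
by apply: oppr_inj; rewrite oppr0 -deriveN// derive_min// => y; rewrite lerN2.
Qed.

End derivative_defaults.

(** * The truncation and its powers *)

Section truncation.
Context {R : realType}.
Implicit Types (t eps m k y z : R).

Definition trunc t eps m y : R := Num.min (Num.max (`|y| - t) eps) m.

Lemma trunc_itv t eps m y : eps <= m -> eps <= trunc t eps m y <= m.
Proof.
move=> em; rewrite /trunc ge_min lexx orbT andbT le_min em andbT.
by rewrite le_max lexx orbT.
Qed.

Lemma trunc_lip t eps m y z : `|trunc t eps m y - trunc t eps m z| <= `|y - z|.
Proof.
have mn (a b c : R) : `|Num.min a c - Num.min b c| <= `|a - b|.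
  have := ler_norm (a - b); have := ler_norm (b - a); rewrite distrC => h1 h2.
  by rewrite ler_norml; case: (leP a c) => ?; case: (leP b c) => ?;
    apply/andP; split; lra.
have mx (a b c : R) : `|Num.max a c - Num.max b c| <= `|a - b|.
  have := ler_norm (a - b); have := ler_norm (b - a); rewrite distrC => h1 h2.
  by rewrite ler_norml; case: (leP a c) => ?; case: (leP b c) => ?;
    apply/andP; split; lra.
rewrite (le_trans (mn _ _ _))// (le_trans (mx _ _ _))//.
by rewrite opprD addrACA opprK addNr addr0 ler_dist_dist.
Qed.

(** Bernoulli's inequality at [b / a] bounds the increment by the slope at [a]; [eps <= a <= m]
    makes the constant uniform. *)
Lemma powR_diff_le eps m k a b : 0 < eps -> 1 <= k -> eps <= b -> b <= a ->
  a <= m -> a `^ k - b `^ k <= k * m `^ k / eps * (a - b).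
Proof.
move=> e0 k1 eb ba am.
have k0 : 0 < k by lra.
have b0 : 0 < b by lra.
have a0 : 0 < a by lra.
have ba0 : 0 < b / a by rewrite divr_gt0.
have h := powR_ge_bernoulli ba0 k1.
have bE : b `^ k = a `^ k * (b / a) `^ k.
  rewrite -powRM ?(ltW a0) ?(ltW ba0)//; congr powR; by rewrite mulrCA divff ?gt_eqF// mulr1.
have h2 : a `^ k - b `^ k <= k * a `^ k / a * (a - b).
  have := ler_wpM2l (powR_ge0 a k) h; rewrite -bE.
  have -> : a `^ k * (1 + k * (b / a - 1)) = a `^ k - k * a `^ k / a * (a - b).
    by field; rewrite gt_eqF.
  lra.
apply: (le_trans h2); rewrite ler_wpM2r ?subr_ge0//.
rewrite ler_pM//; first by rewrite mulr_ge0 ?powR_ge0// ltW.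
- by rewrite invr_ge0 ltW.
- by rewrite ler_wpM2l ?(ltW k0)// ge0_ler_powR ?nnegrE//; lra.
- by rewrite lef_pV2 ?posrE//; lra.
Qed.

Lemma trunc_powR_lip t eps m k y z : 0 < eps -> eps <= m -> 1 <= k ->
  `|trunc t eps m y `^ k - trunc t eps m z `^ k|
    <= k * m `^ k / eps * `|y - z|.
Proof.
move=> e0 em k1; set L := _ / _.
have L0 : 0 <= L by rewrite divr_ge0 ?mulr_ge0 ?powR_ge0//; lra.
apply: (@le_trans _ _ (L * `|trunc t eps m y - trunc t eps m z|)); last first.
  by rewrite ler_wpM2l// trunc_lip.
have /andP[] := trunc_itv t y em; have /andP[] := trunc_itv t z em.
move: (trunc t eps m y) (trunc t eps m z) => a b h1 h2 h3 h4.
wlog ba : a b h1 h2 h3 h4 / b <= a => [hw|].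
  by have [|/ltW] := leP b a => ?; last rewrite distrC [`|a - _|]distrC; apply: hw.
have b0 : 0 < b by lra.
rewrite [X in _ <= L * X]ger0_norm ?subr_ge0// ger0_norm.
  exact: powR_diff_le.
by rewrite subr_ge0 ge0_ler_powR ?nnegrE//; lra.
Qed.

(** Strictly between [eps] and [m], the truncation is [|y| - t] with [y] nonzero; near [y] it
    coincides with the affine function [Num.sg y * z - t] of [z]. *)
Lemma is_derive_trunc_powR t eps m k y : 0 < eps -> 0 <= t ->
  eps < trunc t eps m y -> trunc t eps m y < m ->
  is_derive y (1 : R) (fun z => trunc t eps m z `^ k)
    (Num.sg y * (k * trunc t eps m y `^ (k - 1))).
Proof.
move=> e0 t0 h1 h2.
have [y1 y2] : eps < `|y| - t /\ `|y| - t < m.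
  move: h1 h2; rewrite /trunc lt_min gt_min lt_max gt_max !ltxx !orbF.
  by move=> /andP[-> _] /andP[].
have tE : trunc t eps m y = `|y| - t.
  by rewrite /trunc max_l ?min_l ?ltW.
have yn : y != 0 by rewrite -normr_gt0; lra.
pose phi z := (Num.sg y * z - t) `^ k.
have sy : Num.sg y * y = `|y| by rewrite -normrEsg.
have clin : continuous (fun z => Num.sg y * z - t).
  by move=> z; apply: cvgB; [exact: mulrl_continuous|exact: cvg_cst].
have n1 : \forall z \near y, eps < Num.sg y * z - t.
  by apply: (cvgr_gt _ (clin y)); rewrite sy.
have n2 : \forall z \near y, Num.sg y * z - t < m.
  by apply: (cvgr_lt _ (clin y)); rewrite sy.
have phid : is_derive y (1 : R) phi (Num.sg y * (k * trunc t eps m y `^ (k - 1))).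
  have lin : is_derive y (1 : R) (fun z => Num.sg y * z - t) (Num.sg y).
    have -> : (fun z => Num.sg y * z - t) = (Num.sg y \*: id) - cst t by [].
    by apply: is_derive_eq; rewrite subr0 -[_ *: _]/(_ * _) mulr1.
  rewrite mulrC; apply: (@is_derive1_comp _ (fun a => a `^ k)) => //.
  have -> : trunc t eps m y = Num.sg y * y - t by rewrite sy.
  by apply: is_derive1_powR; rewrite sy; lra.
apply: near_eq_is_derive phid.
near=> z.
have z1 : eps < Num.sg y * z - t by near: z.
have z2 : Num.sg y * z - t < m by near: z.
have zE : `|z| = Num.sg y * z.
  rewrite -[RHS]ger0_norm; last lra.
  by rewrite normrM normr_sg yn mul1r.
by rewrite /phi -zE /trunc max_l ?min_l// zE; lra.
Unshelve. all: by end_near. Qed.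

End truncation.

(** * Locally Lipschitz functions and gradients of truncations *)

Section locally_lipschitz_functions.
Context {R : realType} {n : nat}.
Implicit Types f : 'rV[R]_n -> R.

Lemma locally_lipschitz_continuous f : locally_lipschitz f -> continuous f.
Proof.
move=> lf x; have [U xU /pinfty_ex_gt0[L L0 fL]] := lf x.
apply/(@cvgrPdist_lt _ _ _ (nbhs x) (nbhs_filter x) f (f x)) => e e0.
have eL : 0 < e / L by rewrite divr_gt0.
have /nbhs_singleton Ux := xU.
have xe : \forall y \near x, `|x - y| < e / L by apply/nbhs_normP; exists (e / L).
apply: (@filterS2 _ (nbhs x) (nbhs_filter x) _ _ _ _ xU xe) => y Uy xy.
have := fL (x, y) (conj Ux Uy) => /= /le_lt_trans; apply.
by rewrite mulrC -ltr_pdivlMr.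
Qed.

Lemma locally_lipschitz_comp f (phi : R -> R) (L : R) : 0 <= L ->
  (forall y z, `|phi y - phi z| <= L * `|y - z|) ->
  locally_lipschitz f -> locally_lipschitz (phi \o f).
Proof.
move=> L0 phiL lf x; have [U xU fU] := lf x; exists U => //.
have [M M0 fM] := pinfty_ex_gt0 fU.
exists (L * M); split; first exact: num_real.
move=> A LMA [y z] /= Uyz.
suff : `|phi (f y) - phi (f z)| <= A * `|y - z| by [].
apply: (le_trans (phiL _ _)).
apply: (@le_trans _ _ (L * (M * `|y - z|))).
  by rewrite ler_wpM2l//; exact: (fM (y, z) Uyz).
by rewrite mulrA ler_wpM2r// ltW.
Qed.

Lemma continuous_measurable_rV f :
  continuous f -> measurable_fun setT (f : borel_rV R n -> R).
Proof.
move=> /continuousP cf; apply: (measurability _ (RGenOpens.measurableE R)).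
move=> _ [_ [a [b ->] <-]]; rewrite setTI; apply: sub_sigma_algebra.
exact/cf/interval_open.
Qed.

(* Where the truncation reaches [eps] or [m], its power has a global extremum,
   so that every partial derivative is 0, whether it exists or is a default. *)
Lemma grad_trunc_powR f (t eps m k : R) (x : 'rV[R]_n) :
  continuous f -> 0 < eps -> eps < m -> 0 <= t -> 0 < k ->
  exists2 kappa : R,
    (trunc t eps m (f x) `^ k)^-1 *:
      grad (fun y => trunc t eps m (f y) `^ k) x = kappa *: grad f x &
    kappa = 0 \/ `|kappa| = k / trunc t eps m (f x).
Proof.
move=> cf e0 em t0 k0; set u := trunc t eps m (f x).
have uI y : eps <= trunc t eps m (f y) <= m by apply: trunc_itv; exact: ltW.
have u0 y : 0 < trunc t eps m (f y) by have /andP[+ _] := uI y; exact: lt_le_trans.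
have mono y z : trunc t eps m (f y) <= trunc t eps m (f z) ->
    trunc t eps m (f y) `^ k <= trunc t eps m (f z) `^ k.
  by move=> h; rewrite ge0_ler_powR ?nnegrE// ltW.
have [ue|ue] := eqVneq u eps.
  exists 0; last by left.
  apply/rowP => i; rewrite !mxE mul0r derive_min ?mulr0// => y.
  by apply: mono; rewrite -/u ue; case/andP: (uI y).
have [um|um] := eqVneq u m.
  exists 0; last by left.
  apply/rowP => i; rewrite !mxE mul0r derive_max ?mulr0// => y.
  by apply: mono; rewrite -/u um; case/andP: (uI y).
have /andP[u1 u2] := uI x.
have h1 : eps < u by rewrite lt_neqAle eq_sym ue.
have h2 : u < m by rewrite lt_neqAle um.
(* At a zero of [f] the truncation would be [eps]. So the sign of [f x] is nonzero, and with it the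
   outer derivative, as [derive_comp_default] requires. *)
have fx0 : f x != 0.
  apply: contraTneq h1 => f0; rewrite -leNgt /u f0 /trunc normr0 sub0r max_r.
    by rewrite ge_min lexx.
  by rewrite lerNl (le_trans _ t0)// lerNl oppr0 ltW.
have dphi := is_derive_trunc_powR k e0 t0 h1 h2.
have c0 : Num.sg (f x) * (k * u `^ (k - 1)) != 0.
  by rewrite !mulf_neq0 ?sgr_eq0// gt_eqF// powR_gt0// u0.
exists (Num.sg (f x) * (k / u)).
  apply/rowP => i; rewrite !mxE.
  rewrite (derive_comp_default _ dphi)//; last first.
    have lin : h *: delta_mx 0 i + x @[h --> (0 : R)] --> x.
      rewrite -[X in _ --> X]add0r -(scale0r (delta_mx 0 i : 'rV[R]_n)).
      by apply: cvgD; [exact: cvgZr_tmp|exact: cvg_cst].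
    exact: (cvg_comp _ _ lin (cf x)).
  rewrite -/u mulrA; congr (_ * _).
  have ux : 0 < u by exact: u0.
  rewrite powRB; last by apply/implyP => _; rewrite gt_eqF.
  rewrite powRr1 ?(ltW ux)//.
  by field; rewrite !gt_eqF// powR_gt0.
right; rewrite normrM normr_sg fx0 mul1r ger0_norm// divr_ge0// ltW//.
exact: u0.
Qed.

End locally_lipschitz_functions.

(** * The Luxemburg norm and the growth of [Psi] *)

Section young_function.
Context {R : realType} {n : nat}.
Variable Psi : 'rV[R]_n -> R.
Hypothesis PsiC : condC Psi.
Implicit Types (x : 'rV[R]_n) (p s t : R).

(** By (C5), [Psi (s *: x)] is at most [s / t] times [Psi (t *: x)]. *)
Lemma condC_homo_scale x s t : 0 < s -> s <= t -> Psi (s *: x) <= Psi (t *: x).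
Proof.
move=> s0 st; have t0 : 0 < t by exact: lt_le_trans st.
have := condC_homo PsiC x; move=> /(_ s t); rewrite !in_itv/= !andbT => /(_ s0 t0 st).
rewrite ler_pdivrMr// => /le_trans; apply.
rewrite -mulrA ler_piMr ?(condC_ge0 PsiC)//.
by rewrite mulrC ler_pdivrMr// mul1r.
Qed.

Variable p : R.
Hypothesis p0 : 0 < p.
Local Notation lux := (luxemburg (Psi_scaled Psi p)).

Let luxset x := [set a : R | 0 < a /\ Psi_scaled Psi p (a^-1 *: x) <= 1].

Let luxset_neq0 x : luxset x !=set0.
Proof.
have c0 : Psi y @[y --> (0 : 'rV[R]_n)] --> (0 : R).
  by rewrite -[X in _ --> X](condC_at0 PsiC); exact: condC_cont0.
have lin : p *: (h *: x) @[h --> (0 : R)] --> (0 : 'rV[R]_n).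
  rewrite -[X in _ --> X](scaler0 _ p) -(scale0r x).
  by apply: cvgZl_tmp; exact: cvgZr_tmp.
have := cvg_comp _ _ lin c0 => /cvgrPdist_lt /(_ _ p0) /nbhs_ballP[e /= e0 he].
have e2 : 0 < e / 2 by rewrite divr_gt0.
exists (e / 2)^-1; split; first by rewrite invr_gt0.
rewrite invrK /Psi_scaled ler_pdivrMl// mulr1.
have := he (e / 2); rewrite /ball/= !sub0r !normrN gtr0_norm// => h.
apply: le_trans (ler_norm _) (ltW (h _)).
by rewrite ltr_pdivrMr// ltr_pMr// ltr1n.
Qed.

Lemma luxemburg_ge0 x : 0 <= lux x.
Proof. by apply: (lb_le_inf (luxset_neq0 x)) => a [/ltW]. Qed.

(** By (C3), [Psi] exceeds [p] at all points of norm at least [r], so no admissible [a] is below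
    [p * |x| / r]. *)
Lemma luxemburg_gt0 x : x != 0 -> 0 < lux x.
Proof.
move=> x0; have := condC_infty PsiC (p + 1) => /pinfty_ex_gt0[r r0 hr].
apply: (@lt_le_trans _ _ (p * `|x| / r)).
  by rewrite divr_gt0// mulr_gt0// normr_gt0.
apply: (lb_le_inf (luxset_neq0 x)) => a [a0]; rewrite /Psi_scaled ler_pdivrMl// mulr1 => h.
rewrite ler_pdivrMr// leNgt; apply/negP => ar.
have := hr (p *: (a^-1 *: x)).
rewrite !normrZ !gtr0_norm ?invr_gt0// mulrCA ler_pdivlMl// => /(_ (ltW ar)).
lra.
Qed.

(** The bound holds at all smaller positive multiples of [x], and the left-continuity (C4) carries
    it to [p / lux x]: the infimum is attained. *)
Lemma luxemburg_attained x : x != 0 -> Psi ((p / lux x) *: x) <= p.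
Proof.
move=> x0; have N0 := luxemburg_gt0 x0; set N := lux x in N0 *.
have hlt s : 0 < s -> s < N^-1 -> Psi (s *: (p *: x)) <= p.
  move=> s0 sN; have : inf (luxset x) < s^-1 by rewrite -[X in X < _]invrK ltf_pV2 ?posrE ?invr_gt0.
  move=> /inf_lt -/(_ (luxset_neq0 x))[a [a0 ha] as_].
  move: ha; rewrite /Psi_scaled ler_pdivrMl// mulr1; apply: le_trans.
  rewrite !scalerA [p / a]mulrC -!scalerA; apply: condC_homo_scale => //.
  by rewrite -[s]invrK lef_pV2 ?posrE ?invr_gt0// ltW.
have Ni0 : 0 < N^-1 by rewrite invr_gt0.
have := @condC_left _ _ _ PsiC (p *: x) _ Ni0; rewrite scalerA [N^-1 * p]mulrC.
move=> /cvgr_to_le; apply.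
near=> s; apply: hlt; near: s; [exact: nbhs_left_gt|exact: nbhs_left_lt].
Unshelve. all: by end_near. Qed.

Variables K alpha beta : R.
Hypotheses (K1 : 1 <= K) (PsiG : growth K alpha beta Psi).

(** Up to sign, [k *: x] is [l *: z] with [l] the base of the powers and [Psi z <= p]. Growth from
    [z] gives the exponent [beta] if [1 <= l]; otherwise growth from [l *: z] back to [z] gives
    [alpha]. The sum covers both cases. *)
Lemma Psi_le_luxemburg x k : 
  Psi (k *: x) <= K * p *
    ((`|k| * lux x / p) `^ alpha + (`|k| * lux x / p) `^ beta).
Proof.
have K0 : 0 < K := lt_le_trans ltr01 K1.
have rhs0 : 0 <= K * p * 
    ((`|k| * lux x / p) `^ alpha + (`|k| * lux x / p) `^ beta).
  by rewrite mulr_ge0 ?addr_ge0 ?powR_ge0// mulr_ge0// ltW.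
have [k00|k0] := eqVneq k 0.
  by move: rhs0; rewrite k00 scale0r (condC_at0 PsiC).
have [x00|x0] := eqVneq x 0.
  by rewrite [X in Psi (_ *: X)]x00 scaler0 (condC_at0 PsiC).
have -> : Psi (k *: x) = Psi (`|k| *: x).
  have [kp|kn] := leP 0 k; first by rewrite ger0_norm.
  by rewrite ltr0_norm// scaleNr -(condC_even PsiC).
have k1 : 0 < `|k| by rewrite normr_gt0.
have N0 := luxemburg_gt0 x0; have hN := luxemburg_attained x0.
move: (`|k|) k1 rhs0 => {k0}k k0 _; set N := lux x in N0 hN *.
pose l := k * N / p; rewrite -/l.
have l0 : 0 < l by rewrite divr_gt0// mulr_gt0.
pose z := (p / N) *: x.
have z0 : z != 0 by rewrite scaler_eq0 negb_or x0 andbT gt_eqF// divr_gt0.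
have kx : k *: x = l *: z.
  by rewrite scalerA; congr (_ *: _); rewrite /l; field; rewrite !gt_eqF.
have Pz : 0 < Psi z by exact: condC_gt0.
have Pa := powR_ge0 l alpha; have Pb := powR_ge0 l beta.
have Kp : 0 < K * p by rewrite mulr_gt0.
rewrite kx; have [l1|l1] := leP 1 l.
  have /andP[_] := PsiG z0 l1; rewrite ler_pdivrMr// => /le_trans; apply.
  apply: (@le_trans _ _ (K * l `^ beta * p)).
    by rewrite ler_wpM2l// mulr_ge0// ltW.
  by rewrite mulrAC ler_wpM2l ?(ltW Kp)// lerDr.
have lz0 : l *: z != 0 by rewrite scaler_eq0 negb_or z0 gt_eqF.
have il1 : 1 <= l^-1 by rewrite invf_ge1// ltW.
have /andP[+ _] := PsiG lz0 il1.
rewrite scalerA mulVf ?gt_eqF// scale1r ler_pdivlMr ?(condC_gt0 PsiC)//.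
rewrite powRV// -invfM.
rewrite mulrC ler_pdivrMr ?mulr_gt0 ?powR_gt0// => /le_trans; apply.
apply: (@le_trans _ _ (p * (K * l `^ alpha))).
  by rewrite ler_wpM2r// mulr_ge0// ltW.
by rewrite mulrCA mulrA ler_wpM2l ?(ltW Kp)// lerDl.
Qed.

End young_function.

(** * The energy term of the inequality *)

Section energy.
Context d (T : measurableType d) (R : realType).
Variable mu : probability T R.

(** Integrates [young_moment] for both exponents: its weights sum to 1 and each normalised power has
    mean at most 1. The disjunction allows a gradient of infinite norm when [D = 0]. *)
Lemma energy_le (u N Phi : T -> R) (c C alpha beta s p K D A B h : R) :
  measurable_fun setT u -> 0 < c -> (forall x, c <= u x <= C) ->
  (forall x, 0 <= N x) -> (forall x, 0 <= Phi x) ->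
  1 <= alpha -> alpha <= beta -> 2 <= beta -> beta <= s -> s <= p ->
  0 <= K -> 0 <= D -> 0 < A -> 0 < B ->
  K * D <= (B / A) `^ alpha -> K * D <= (B / A) `^ beta ->
  D = 0 \/ (\int[mu]_x (N x `^ p)%:E <= (A `^ p)%:E)%E ->
  (forall x, Phi x <= K * p *
    ((s / (2 * u x) * N x / p) `^ alpha + (s / (2 * u x) * N x / p) `^ beta) *
      u x `^ s) ->
  0 < h -> h `^ s = \int[mu]_x (u x `^ s) -> B <= h ->
  (D%:E * \int[mu]_x (Phi x)%:E <=
    (3 / 4 * (p * (s / p) `^ alpha * (B / h)) * h `^ s)%:E)%E.
Proof.
move=> mu_ c0 uc N0 Phi0 alpha1 ab beta2 bs sp K0 D0 A0 B0 KDa KDb HA Phile h0 hM Bh.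
have s0 : 0 < s by lra.
have p0 : 0 < p by lra.
have u0 x : 0 < u x by have /andP[+ _] := uc x; exact: lt_le_trans.
pose P := p * (s / p) `^ alpha.
have P0 : 0 <= P by rewrite mulr_ge0 ?powR_ge0// ltW.
have sp0 : 0 < s / p by rewrite divr_gt0.
pose C1 := (B / (2 * h)) `^ alpha; pose C2 := (B / (2 * h)) `^ beta.
have C10 : 0 <= C1 by exact: powR_ge0.
have C20 : 0 <= C2 by exact: powR_ge0.
have Bh2 : 0 < B / (2 * h) by rewrite divr_gt0// mulr_gt0.
(* Since [1 <= alpha] and [2 <= beta], this gives [C1 <= B / (2 * h)] and [C2] at most half of that
   bound; the sum is [3 / 4 * (B / h)]. *)
have Bh1 : B / (2 * h) <= 1 / 2.
  by rewrite ler_pdivrMr ?mulr_gt0//; lra.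
have C1le : C1 <= B / (2 * h).
  rewrite /C1 -[leRHS]powRr1 ?(ltW Bh2)// !powRE// ler_expR ler_wnM2r//.
  by rewrite ln_le0//; lra.
have C2le : C2 <= B / (2 * h) * (1 / 2).
  apply: (@le_trans _ _ ((B / (2 * h)) `^ 2)).
    by rewrite /C2 !powRE// ler_expR ler_wnM2r// ln_le0//; lra.
  by rewrite powR_mulrn ?(ltW Bh2)// expr2 ler_wpM2l ?(ltW Bh2).
pose M := h `^ s.
have M0 : 0 < M by exact: powR_gt0.
(* Coefficients of the power of [N], of the power of [u] and of 1 in the two added Young bounds. *)
pose a := P * M * (C1 * (alpha / p) + C2 * (beta / p)) / A `^ p.
pose g1 := P * (C1 * (1 - alpha / s) + C2 * (1 - beta / s)).
pose g2 := P * M * (C1 * (alpha / s - alpha / p) + C2 * (beta / s - beta / p)).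
have al0 : 0 < alpha by lra.
have be0 : 0 < beta by lra.
have q1 r : 0 < r -> r <= s -> [/\ 0 <= r / p, 0 <= 1 - r / s & 0 <= r / s - r / p].
  move=> r0 rs; split; first by rewrite divr_ge0// ltW.
    by rewrite subr_ge0 ler_pdivrMr// mul1r.
  by rewrite subr_ge0 ler_wpM2l ?(ltW r0)// lef_pV2 ?posrE.
have [qa1 qa2 qa3] := q1 alpha al0 (le_trans ab bs).
have [qb1 qb2 qb3] := q1 beta be0 bs.
have a_ge0 : 0 <= a.
  rewrite /a; apply: divr_ge0; last exact: powR_ge0.
  by rewrite mulr_ge0 ?addr_ge0// mulr_ge0// ltW.
have g10 : 0 <= g1 by rewrite /g1 mulr_ge0 ?addr_ge0// mulr_ge0.
have g20 : 0 <= g2.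
  by rewrite /g2 mulr_ge0 ?addr_ge0// mulr_ge0// ltW.
have mus : measurable_fun setT (fun x => u x `^ s).
  exact: (measurableT_comp (@measurable_powR R s)).
have ius : mu.-integrable setT (EFin \o (fun x => u x `^ s)).
  apply: (@integrable_bounded _ _ _ _ _ (C `^ s)) => // x.
  have /andP[h1 h2] := uc x; rewrite ger0_norm ?powR_ge0//.
  by rewrite ge0_ler_powR ?nnegrE ?(ltW s0) ?(ltW (u0 x)) ?(le_trans (ltW (u0 x)) h2).
have pointwise x : D * Phi x <= a * N x `^ p + (g1 * u x `^ s + g2).
  apply: (le_trans (ler_wpM2l D0 (Phile x))).
  have split r : 0 < r -> (s / (2 * u x) * N x / p) `^ r =
      (s / p) `^ r * (N x / (2 * u x)) `^ r.
    move=> r0; rewrite -powRM ?(ltW sp0) ?divr_ge0 ?mulr_ge0// ?(ltW (u0 x))//.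
    by congr (_ `^ _); field; rewrite !gt_eqF.
  rewrite !split//.
  have pab : (s / p) `^ beta <= (s / p) `^ alpha.
    rewrite !powRE// ler_expR ler_wnM2r// ln_le0//.
    by rewrite ler_pdivrMr// mul1r.
  have y1 := @young_moment R alpha s p (N x) (u x) A h B (K * D) al0
    (le_trans ab bs) sp (N0 x) (u0 x) A0 h0 B0 (mulr_ge0 K0 D0) KDa.
  have y2 := @young_moment R beta s p (N x) (u x) A h B (K * D) be0
    bs sp (N0 x) (u0 x) A0 h0 B0 (mulr_ge0 K0 D0) KDb.
  have NA : (N x / A) `^ p = N x `^ p / A `^ p.
    rewrite powRM ?invr_ge0 ?(ltW A0)//; congr (_ * _).
    exact: powRV.
  have uh : (u x / h) `^ s = u x `^ s / M.
    rewrite powRM ?invr_ge0 ?(ltW h0) ?(ltW (u0 x))//; congr (_ * _).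
    exact: powRV.
  rewrite NA uh -/C1 -/M in y1; rewrite NA uh -/C2 -/M in y2.
  set na := (N x / _) `^ alpha in y1 *; set nb := (N x / _) `^ beta in y2 *.
  have nb0 : 0 <= nb by exact: powR_ge0.
  have us0 : 0 <= u x `^ s by exact: powR_ge0.
  apply: (@le_trans _ _ (P * (K * D * na * u x `^ s + K * D * nb * u x `^ s))).
    rewrite (_ : P * _ = D * (K * p * ((s / p) `^ alpha * na + (s / p) `^ alpha * nb) * u x `^ s)); last by rewrite /P; ring.
    apply: ler_wpM2l => //; apply: ler_wpM2r => //.
    apply: ler_wpM2l; first by rewrite mulr_ge0// ltW.
    by rewrite lerD2l ler_wpM2r.
  apply: (le_trans (ler_wpM2l P0 (lerD y1 y2))).
  rewrite le_eqVlt; apply/orP; left; apply/eqP.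
  rewrite /a /g1 /g2; field.
  by rewrite !gt_eqF// powR_gt0.
have := @integral_le_add_nonmeas _ _ _ mu D a Phi (fun x => N x `^ p)
  (fun x => g1 * u x `^ s + g2) D0 a_ge0 Phi0 (fun x => powR_ge0 _ _).
have [D00|NA] := HA.
  by move=> _; rewrite D00 mul0e lee_fin !mulr_ge0 ?invr_ge0 ?powR_ge0// ltW.
have gge0 x : 0 <= g1 * u x `^ s + g2 by rewrite addr_ge0// mulr_ge0// powR_ge0.
have mg : measurable_fun setT (fun x => g1 * u x `^ s + g2).
  by apply: measurable_funD => //; exact: measurable_funM.
move=> /(_ gge0 mg pointwise) H; apply: le_trans H _.
have -> : (\int[mu]_x (g1 * u x `^ s + g2)%:E = (g1 * M + g2)%:E)%E.
  have i1 : mu.-integrable setT (EFin \o (fun x => g1 * u x `^ s)).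
    by rewrite (_ : _ \o _ = fun x => (g1%:E * (u x `^ s)%:E)%E)//; exact: integrableZl.
  have i2 : mu.-integrable setT (EFin \o (fun=> g2)).
    exact: (@integrable_bounded _ _ _ _ _ `|g2|).
  have i3 : mu.-integrable setT (EFin \o (fun x => g1 * u x `^ s + g2)).
    rewrite (_ : _ \o _ = (EFin \o (fun x => g1 * u x `^ s)%R) \+ (EFin \o (fun=> g2)))%E//.
    exact: integrableD.
  rewrite -[LHS]fineK; last exact: integrable_fin_num.
  congr EFin; rewrite -[LHS]/(\int[mu]_x (g1 * u x `^ s + g2)).
  by rewrite RintegralD// RintegralZl// -hM -/M Rintegral_probability_cst.
apply: (@le_trans _ _ (a%:E * (A `^ p)%:E + (g1 * M + g2)%:E)%E).
  by rewrite leeD2r// lee_wpmul2l// lee_fin.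
rewrite -EFinM -EFinD lee_fin -/M.
have -> : a * A `^ p + (g1 * M + g2) = P * M * (C1 + C2).
  rewrite /a /g1 /g2; field.
  by rewrite !gt_eqF// powR_gt0.
have -> : 3 / 4 * (p * (s / p) `^ alpha * (B / h)) * M =
  P * M * (B / (2 * h) + B / (2 * h) * (1 / 2)).
  by rewrite /P; field; rewrite gt_eqF.
by rewrite ler_wpM2l ?lerD// mulr_ge0// ltW.
Qed.

End energy.

(** Both integrals are finite and the mean is positive, so [lne] reduces to [ln]. *)
Lemma Ent_entropy {R : realType} {n : nat} (mu : probability (borel_rV R n) R)
    (F : 'rV[R]_n -> R) (c C : R) :
  measurable_fun setT (F : borel_rV R n -> R) -> 0 < c ->
  (forall x, c <= F x <= C) ->
  Ent mu F = (entropy mu (F : borel_rV R n -> R))%:E.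
Proof.
move=> mF c0 FC.
have F0 x : 0 < F x by have /andP[+ _] := FC x; exact: lt_le_trans.
have iF : mu.-integrable setT (EFin \o (F : borel_rV R n -> R)).
  apply: (@integrable_bounded _ _ _ _ _ C) => // x.
  by rewrite gtr0_norm//; case/andP: (FC x).
have iFl := integrable_mul_ln mu mF c0 FC.
have M0 : 0 < \int[mu]_x (F : borel_rV R n -> R) x.
  by apply: (Rintegral_gt0 c0 iF) => x; case/andP: (FC x).
have ME : (\int[mu]_x ((F : borel_rV R n -> R) x)%:E =
    (\int[mu]_x (F : borel_rV R n -> R) x)%:E)%E.
  by rewrite /Rintegral fineK//; exact: (integrable_fin_num measurableT iF).
rewrite /Ent ME lne_EFin// -EFinM /entropy EFinB; congr (_ - _)%E.
by rewrite /Rintegral fineK//; exact: (integrable_fin_num measurableT iFl).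
Qed.

(** * Moments of the truncated function under the logarithmic Sobolev inequality *)

Section entropy_estimate.
Context {R : realType} {n : nat}.
Variables (alpha beta K D d : R) (Psi : 'rV[R]_n -> R).
Variable mu : probability (borel_rV R n) R.
Hypotheses (alpha_gt1 : 1 < alpha) (alpha_le2 : alpha <= 2).
Hypotheses (beta_ge2 : 2 <= beta) (K_ge1 : 1 <= K).
Hypotheses (PsiC : condC Psi) (PsiG : growth K alpha beta Psi).
Hypotheses (D_ge0 : 0 <= D) (mu_dmLSI : dmLSI mu Psi D d).

Variables (f : 'rV[R]_n -> R) (p t eps m A B : R).
Hypotheses (lf : locally_lipschitz f) (beta_p : beta <= p).
Hypotheses (t0 : 0 <= t) (eps0 : 0 < eps) (epsm : eps < m).
Hypotheses (A0 : 0 < A) (B0 : 0 < B).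
Hypotheses (KDa : K * D <= (B / A) `^ alpha) (KDb : K * D <= (B / A) `^ beta).

Let N (x : borel_rV R n) : R := luxemburg (Psi_scaled Psi p) (grad f x).
Hypothesis HA : D = 0 \/ (\int[mu]_x (N x `^ p)%:E <= (A `^ p)%:E)%E.

Definition truncf (x : borel_rV R n) : R := trunc t eps m (f x).
Local Notation u := truncf.
Definition moment s : R := \int[mu]_x (u x `^ s).
Definition momentnorm s : R := moment s `^ s^-1.

Let p0 : 0 < p.
Proof. by have h1 := beta_p; have h2 := beta_ge2; lra. Qed.
Let m0 : 0 < m. Proof. exact: lt_trans epsm. Qed.

Lemma truncf_itv x : eps <= u x <= m.
Proof. by apply: trunc_itv; exact: ltW. Qed.

Let u0 x : 0 < u x.
Proof. by have /andP[+ _] := truncf_itv x; exact: lt_le_trans. Qed.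

Lemma measurable_truncf : measurable_fun setT u.
Proof.
apply: continuous_measurable_rV; apply: locally_lipschitz_continuous.
apply: (@locally_lipschitz_comp _ _ f (trunc t eps m) 1) => // y z.
by rewrite mul1r; exact: trunc_lip.
Qed.

Lemma truncf_powR_itv s x : 0 < s -> eps `^ s <= u x `^ s <= m `^ s.
Proof.
move=> s0; have /andP[h1 h2] := truncf_itv x.
by rewrite !ge0_ler_powR ?nnegrE ?(ltW s0) ?(ltW eps0) ?(ltW (u0 x)) ?(ltW m0).
Qed.

Lemma measurable_truncf_powR s : measurable_fun setT (fun x => u x `^ s).
Proof. exact: (measurableT_comp (@measurable_powR R s) measurable_truncf). Qed.

Lemma integrable_truncf_powR s : 0 < s ->
  mu.-integrable setT (EFin \o (fun x => u x `^ s)).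
Proof.
move=> s0; apply: (@integrable_bounded _ _ _ _ _ (m `^ s)).
  exact: measurable_truncf_powR.
move=> x; rewrite ger0_norm ?powR_ge0//.
by have /andP[] := truncf_powR_itv x s0.
Qed.

Lemma moment_gt0 s : 0 < s -> 0 < moment s.
Proof.
move=> s0; apply: (Rintegral_gt0 (powR_gt0 s eps0) (integrable_truncf_powR s0)).
by move=> x; have /andP[] := truncf_powR_itv x s0.
Qed.

Lemma momentnorm_gt0 s : 0 < s -> 0 < momentnorm s.
Proof. by move=> s0; rewrite powR_gt0// moment_gt0. Qed.

Lemma momentnormK s : 0 < s -> momentnorm s `^ s = moment s.
Proof.
move=> s0; rewrite /momentnorm -powRrM mulVf ?gt_eqF// powRr1//.
by rewrite ltW// moment_gt0.
Qed.

(** The test function is [w], the power [s / 2] of [u]; the truncation makes it positive, bounded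
    and locally Lipschitz. Its logarithmic gradient is [grad f] times a factor of size at most
    [s / (2 * u)], and [energy_le] applies. *)
Lemma entropy_moment_le s : beta <= s -> s <= p -> B <= momentnorm s ->
  entropy mu (fun x => u x `^ s) <=
    (3 / 4 * (p * (s / p) `^ alpha * (B / momentnorm s)) + d) * moment s.
Proof.
move=> bs sp Bh.
have b2 := beta_ge2; have al1 := alpha_gt1; have al2 := alpha_le2.
have m00 := m0; have e00 := eps0; have p00 := p0; have K1 := K_ge1.
have s0 : 0 < s by lra.
have s20 : 0 < s / 2 by lra.
have s21 : 1 <= s / 2 by lra.
pose w (x : 'rV[R]_n) := u x `^ (s / 2).
have w2 x : w x ^+ 2 = u x `^ s.
  by rewrite /w -powR_mulrn ?powR_ge0// -powRrM divfK.
have w0 x : 0 < w x by exact: powR_gt0.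
have lw : locally_lipschitz w.
  apply: (@locally_lipschitz_comp _ _ f (fun y => trunc t eps m y `^ (s / 2))
      (s / 2 * m `^ (s / 2) / eps)) => //.
    by rewrite divr_ge0 ?mulr_ge0 ?powR_ge0//; lra.
  by move=> y z; apply: trunc_powR_lip => //; exact: ltW.
have bw : bounded_fun w.
  exists (m `^ (s / 2)); split; first exact: num_real.
  move=> C mC x _; apply: le_trans (ltW mC); rewrite gtr0_norm//.
  by have /andP[] := truncf_powR_itv x s20.
have := mu_dmLSI w0 bw lw.
have -> : (fun x => w x ^+ 2) = (fun x => u x `^ s) by apply/funext.
rewrite (@Ent_entropy _ _ _ _ (eps `^ s) (m `^ s)); last 3 first.
- exact: measurable_truncf_powR.
- exact: powR_gt0.
- by move=> x; exact: truncf_powR_itv.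
have -> : (\int[mu]_x (w x ^+ 2)%:E = (moment s)%:E)%E.
  under eq_integral do rewrite w2.
  rewrite /moment /Rintegral fineK//.
  exact: (integrable_fin_num measurableT (integrable_truncf_powR s0)).
move=> le; rewrite -lee_fin; apply: (le_trans le).
rewrite -EFinM mulrDl EFinD leeD2r// -(momentnormK s0).
apply: (@energy_le _ _ _ mu u N _ eps m alpha beta s p K D A B) => //.
- exact: measurable_truncf.
- exact: truncf_itv.
- by move=> x; exact: luxemburg_ge0.
- by move=> x; rewrite mulr_ge0 ?sqr_ge0//; exact: (condC_ge0 PsiC).
- exact: ltW.
- lra.
- lra.
- move=> x; rewrite w2 ler_wpM2r ?powR_ge0//.
  have [k -> kE] := grad_trunc_powR x (locally_lipschitz_continuous lf) eps0
    epsm t0 s20.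
  apply: le_trans (Psi_le_luxemburg PsiC p0 K_ge1 PsiG _ _) _.
  rewrite ler_wpM2l//; first by rewrite mulr_ge0//; lra.
  have kle : `|k| <= s / (2 * u x).
    case: kE => [->|->]; first by rewrite normr0 divr_ge0 ?mulr_ge0 ?ltW.
    by rewrite invfM mulrA.
  have Nx0 := luxemburg_ge0 PsiC p0 (grad f x).
  have le1 : `|k| * N x / p <= s / (2 * u x) * N x / p.
    by rewrite ler_wpM2r ?invr_ge0 ?(ltW p0)// ler_wpM2r.
  have ge0 : 0 <= `|k| * N x / p by rewrite divr_ge0 ?mulr_ge0 ?(ltW p0).
  have ge0' := le_trans ge0 le1.
  by rewrite lerD// ge0_ler_powR ?nnegrE//; lra.
- exact: momentnorm_gt0.
- exact: momentnormK.
Qed.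


(** Jensen's inequality turns the entropy bound into the step of [moment_recursion] with
    [a = alpha - 1] and [q = 5 / 4]. The pair [d'], [lam] will be [d], 3/4 for a small defect and 0,
    5/2 for a large one. *)
Lemma momentnorm_le (d' lam : R) : 0 <= d' -> 0 <= lam ->
  (forall s, beta <= s -> s <= p -> B <= momentnorm s ->
    entropy mu (fun x => u x `^ s) <=
      (lam * (p * (s / p) `^ alpha * (B / momentnorm s)) + d') * moment s) ->
  momentnorm p <= expR (d' / beta) *
    (Num.max (momentnorm beta) B + lam * (5 / 4 / (alpha - 1)) * B).
Proof.
move=> d'0 lam0 ent.
have b2 := beta_ge2; have al1 := alpha_gt1; have al2 := alpha_le2.
apply: moment_recursion => //; try lra.
move=> r s br rs _ sp Bh.
have r0 : 0 < r by lra.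
have s0 : 0 < s by lra.
have := moment_le_entropy mu measurable_truncf eps0 truncf_itv r0 rs.
rewrite -/(moment r) -/(moment s) -/(momentnorm r) -/(momentnorm s).
move=> /le_trans; apply; rewrite ler_wpM2l ?powR_ge0// ler_expR.
rewrite ler_wpM2l ?subr_ge0 ?lef_pV2 ?posrE//.
rewrite ler_pdivrMr ?moment_gt0//; apply: (le_trans (ent s _ sp Bh)); first lra.
rewrite ler_wpM2r//; first by rewrite ltW// moment_gt0.
have -> : 1 + (alpha - 1) = alpha by ring.
by rewrite le_eqVlt; apply/orP; left; apply/eqP; ring.
Qed.

Hypothesis d_ge0 : 0 <= d.

(** The series costs 15/16 of [B / (alpha - 1)] and the maximum one more [B]; since [alpha - 1 <= 1]
    this is at most [2 * (B / (alpha - 1))], and [d / beta <= 1] gives the factor [expR 1]. *)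
Lemma momentnorm_le_small : d <= beta ->
  momentnorm p <= expR (d / beta) * momentnorm beta +
    2 * expR 1 / (alpha - 1) * B.
Proof.
move=> db; have b2 := beta_ge2; have al1 := alpha_gt1; have al2 := alpha_le2.
have B00 := B0.
have a0 : 0 < alpha - 1 by lra.
have db1 : d / beta <= 1 by rewrite ler_pdivrMr ?mul1r//; lra.
apply: (le_trans (@momentnorm_le d (3 / 4) d_ge0 _ _)); first lra.
  by move=> s bs sp Bh; exact: entropy_moment_le.
have h0 : 0 < momentnorm beta by apply: momentnorm_gt0; lra.
have B1 : B <= B / (alpha - 1).
  by rewrite ler_pdivlMr// ler_piMr ?(ltW B00)//; lra.
have max_le : Num.max (momentnorm beta) B <= momentnorm beta + B.
  by rewrite ge_max; apply/andP; split; lra.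
apply: (@le_trans _ _ (expR (d / beta) * (momentnorm beta + 2 * (B / (alpha - 1))))).
  rewrite ler_wpM2l ?expR_ge0//.
  have -> : 3 / 4 * (5 / 4 / (alpha - 1)) * B = 15 / 16 * (B / (alpha - 1)).
    by field; rewrite gt_eqF.
  lra.
rewrite mulrDr lerD2l.
have -> : 2 * expR 1 / (alpha - 1) * B = expR 1 * (2 * (B / (alpha - 1))).
  by field; rewrite gt_eqF.
by rewrite ler_wpM2r ?ler_expR// mulr_ge0// divr_ge0 ?ltW.
Qed.

(** * The case of a defect larger than [beta] *)

Hypothesis beta_lt_d : beta < d.
Hypothesis t_gt0 : 0 < t.
Hypothesis eps_le : 16 * d * p * eps <= B.
Hypothesis intf : mu.-integrable setT
  (EFin \o (fun x : borel_rV R n => (`|f x| / t) `^ beta)).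
Hypothesis intf_le :
  \int[mu]_x ((fun x : borel_rV R n => (`|f x| / t) `^ beta) x) <=
    expR (- (2 * d)).

Let X s := p * (s / p) `^ alpha * (B / momentnorm s).

(** [entropy_ge] with [a = 2 * d] and [tau] the power of [eps]. The bound [eps_le] makes the term in
    [tau] a small part of [X s * moment s]. *)
Let moment_le_entropy_large s : beta <= s -> s <= p -> B <= momentnorm s ->
  (2 * d - 1) * moment s <=
    entropy mu (fun x => u x `^ s) + 1 / 8 * (X s * moment s) /\
  4 * d * eps `^ s <= 1 / 4 * (X s * moment s).
Proof.
move=> bs sp Bh; have b2 := beta_ge2; have al1 := alpha_gt1; have al2 := alpha_le2.
have bd := beta_lt_d; have B00 := B0; have p00 := p0; have e00 := eps0.
have s0 : 0 < s by lra.
have h0 := momentnorm_gt0 s0; have M0 := moment_gt0 s0.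
have small : 4 * d * eps `^ s <= 1 / 4 * (X s * moment s).
  have epsB : eps <= B.
    apply: le_trans eps_le; rewrite -[leLHS]mul1r ler_wpM2r ?(ltW e00)//.
    have : 1 <= d * p by rewrite -[1]mulr1 ler_pM//; lra.
    by rewrite -mulrA; lra.
  have eh : eps `^ s <= eps / momentnorm s * moment s.
    rewrite -(momentnormK s0) -{1}(divfK (lt0r_neq0 h0) eps).
    have eh0 : 0 < eps / momentnorm s by rewrite divr_gt0.
    rewrite powRM ?(ltW eh0) ?(ltW h0)// ler_wpM2r ?powR_ge0//.
    rewrite -[leRHS]powRr1 ?(ltW eh0)// !powRE// ler_expR ler_wnM2r//; last lra.
    by rewrite ln_le0// ler_pdivrMr// mul1r; exact: le_trans Bh.
  apply: (@le_trans _ _ (4 * d * (eps / momentnorm s * moment s))).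
    by rewrite ler_wpM2l//; lra.
  rewrite !mulrA ler_wpM2r ?(ltW M0)// ler_wpM2r ?invr_ge0 ?(ltW h0)//.
  (* Because [alpha <= 2] and [s <= p], the right side is at least [s * s / p], and [2 <= s]. *)
  have pw : 4 / p <= p * (s / p) `^ alpha.
    have sp0 : 0 < s / p by rewrite divr_gt0.
    apply: (@le_trans _ _ (p * (s / p) `^ 2)); last first.
      rewrite ler_wpM2l ?(ltW p00)// !powRE// ler_expR ler_wnM2r//.
      by rewrite ln_le0// ler_pdivrMr// mul1r.
    rewrite powR_mulrn ?(ltW sp0)// expr2.
    have -> : p * (s / p * (s / p)) = s * s / p by field; rewrite gt_eqF.
    rewrite ler_wpM2r ?invr_ge0 ?(ltW p00)//.
    have -> : (4 : R) = 2 * 2 by ring.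
    by rewrite ler_pM//; lra.
  have : 16 * d * eps <= B / p by rewrite ler_pdivlMr// mulrAC.
  have := ler_wpM2r (ltW B00) pw.
  have -> : 4 / p * B = 4 * (B / p) by ring.
  have : 0 <= B / p by rewrite divr_ge0 ?ltW.
  rewrite [1 / 4 * _ * _]mulrAC -!mulrA; lra.
split=> //.
have fxG x : u x `^ s = eps `^ s \/ 1 <= (`|f x| / t) `^ beta.
  have [fxt|tfx] := leP `|f x| t.
    left; congr (_ `^ _); rewrite /truncf /trunc max_r.
      by rewrite min_l// ltW.
    lra.
  right; apply: (@le_trans _ _ (1 `^ beta)); first by rewrite powR1.
  rewrite ge0_ler_powR ?nnegrE//; [lra| |].
    by rewrite divr_ge0.
  by rewrite ler_pdivlMr// mul1r ltW.
have d20 : 0 <= 2 * d by lra.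
have := entropy_ge (measurable_truncf_powR s) (powR_gt0 s e00)
  (fun x => truncf_powR_itv x s0) d20 intf (fun x => powR_ge0 _ _) intf_le fxG.
rewrite -/(moment s); lra.
Qed.

(* The entropy lower bound absorbs the defect [d], so that the recursion runs
   without it. *)
Lemma momentnorm_le_large :
  momentnorm p <= 2 * expR 1 / (alpha - 1) * B.
Proof.
have b2 := beta_ge2; have al1 := alpha_gt1; have al2 := alpha_le2.
have bd := beta_lt_d; have B00 := B0; have p00 := p0.
have a0 : 0 < alpha - 1 by lra.
(* As [2 <= d], the defect is at most 2/3 of [2 * d - 1]. So the entropy is at most 2/3 of itself
   plus [3 / 4 + 1 / 12 = 5 / 6] of [X s * moment s], whence 5/2. *)
have ent s : beta <= s -> s <= p -> B <= momentnorm s ->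
    entropy mu (fun x => u x `^ s) <= 5 / 2 * (X s * moment s).
  move=> bs sp Bh; have [h1 h2] := moment_le_entropy_large bs sp Bh.
  have := entropy_moment_le bs sp Bh; rewrite -/(X s) mulrDl -mulrA => h3.
  have M0 : 0 < moment s by apply: moment_gt0; lra.
  have h4 : d * moment s <= 2 / 3 * ((2 * d - 1) * moment s).
    by rewrite mulrA ler_wpM2r ?(ltW M0)//; lra.
  lra.
(* At [s = beta] the two entropy bounds give [2 * d - 1 <= 21 / 8 * X beta], while
   [X beta <= d * B / momentnorm beta]. Cancelling [d] leaves a starting moment of the order of
   [B]. *)
have hb : momentnorm beta <= 2 * B.
  have [|Bh] := ltP (momentnorm beta) B; first by lra.
  have be0 : 0 < beta by lra.
  have [h1 _] := moment_le_entropy_large (lexx beta) beta_p Bh.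
  have h2 := ent _ (lexx beta) beta_p Bh.
  have M0 := moment_gt0 be0; have h0 := momentnorm_gt0 be0.
  have Xle : X beta <= d * B / momentnorm beta.
    rewrite /X mulrA ler_wpM2r ?invr_ge0 ?(ltW h0)// ler_wpM2r ?(ltW B00)//.
    have bp0 : 0 < beta / p by rewrite divr_gt0.
    apply: (@le_trans _ _ beta); last exact: ltW.
    apply: (@le_trans _ _ (p * (beta / p))).
      rewrite ler_wpM2l ?(ltW p00)// -[leRHS]powRr1 ?(ltW bp0)//.
      rewrite !powRE// ler_expR ler_wnM2r//; last lra.
      by rewrite ln_le0// ler_pdivrMr// mul1r.
    by rewrite mulrCA divff ?gt_eqF// mulr1.
  have h3 : (2 * d - 1) * moment beta <= 21 / 8 * X beta * moment beta by lra.
  rewrite ler_pM2r// in h3.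
  have h4 : d <= 7 / 4 * (d * B / momentnorm beta) by lra.
  have d0 : 0 < d by lra.
  have : momentnorm beta <= 7 / 4 * B.
    move: h4; rewrite -(ler_pM2r h0) -[7 / 4 * _ * _]mulrA divfK ?gt_eqF//.
    by rewrite mulrCA ler_pM2l.
  lra.
have l0 : 0 <= 5 / 2 :> R by lra.
have H := @momentnorm_le 0 (5 / 2) (lexx 0) l0.
have E0 : expR (0 / beta) = 1 by rewrite mul0r expR0.
rewrite E0 [1 * _]mul1r in H; apply: (le_trans (H _)).
  by move=> s bs sp Bh; rewrite addr0 -mulrA; exact: ent.
clear H.
(* In units of [B / (alpha - 1)] the maximum and the series cost [2 + 25 / 8 = 41 / 8], to be
   compared with [2 * expR 1]. *)
have e1 : 41 / 16 <= expR 1 :> R.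
  have -> : expR 1 = expR (1 / 8) ^+ 8 :> R.
    by rewrite -expRM_natl; congr expR; field.
  apply: (@le_trans _ _ ((1 + 1 / 8) ^+ 8)); first by rewrite !exprS expr0; lra.
  have e8 : 0 <= 1 + 1 / 8 :> R by lra.
  by rewrite lerXn2r ?nnegrE ?expR_ge0 ?expR_ge1Dx.
have max_le : Num.max (momentnorm beta) B <= 2 * B.
  by rewrite ge_max hb/=; lra.
have B1 : B <= B / (alpha - 1).
  by rewrite ler_pdivlMr// ler_piMr ?(ltW B00)//; lra.
have -> : 5 / 2 * (5 / 4 / (alpha - 1)) * B = 25 / 8 * (B / (alpha - 1)).
  by field; rewrite gt_eqF.
have -> : 2 * expR 1 / (alpha - 1) * B = 2 * expR 1 * (B / (alpha - 1)) by ring.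
have : 41 / 8 * (B / (alpha - 1)) <= 2 * expR 1 * (B / (alpha - 1)).
  apply: ler_wpM2r; last lra.
  exact: le_trans (ltW B00) B1.
lra.
Qed.

End entropy_estimate.

(** * Adding the threshold back *)

Section shifted_powers.
Context {R : realType}.

Lemma trunc_add_ge (t eps m y : R) : 0 <= t ->
  Num.min `|y| m <= t + trunc t eps m y.
Proof.
move=> t0; have h1 : Num.min `|y| m <= `|y| by rewrite ge_min lexx.
have h2 : Num.min `|y| m <= m by rewrite ge_min lexx orbT.
have h3 : `|y| - t <= Num.max (`|y| - t) eps by rewrite le_max lexx.
rewrite -lerBlDl /trunc le_min; apply/andP; split; lra.
Qed.

(** Convexity of the power: [t + v] is the mean of [t + H] and [(t + H) * (v / H)] with the weights
    shown. With [H] the [p]-norm of a function [v], integration gives Minkowski's inequality for a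
    constant summand. *)
Lemma powR_add_le (t v H p : R) : 0 <= t -> 0 < v -> 0 < H -> 1 <= p ->
  (t + v) `^ p <= (t + H) `^ p * (t / (t + H) + H / (t + H) * (v / H) `^ p).
Proof.
move=> t0 v0 H0 p1.
have S0 : 0 < t + H by lra.
have V0 : 0 < t + v by lra.
pose x := (t + v) / (t + H).
have x0 : 0 < x by rewrite divr_gt0.
have h1 : x `^ p * (1 + p * (x^-1 - 1)) <= 1.
  have xi : 0 < x^-1 by rewrite invr_gt0.
  have := ler_wpM2l (powR_ge0 x p) (powR_ge_bernoulli xi p1).
  by rewrite -powRM ?(ltW x0) ?(ltW xi)// divff ?gt_eqF// powR1.
have h2 : x `^ p * (1 + p * (v / H / x - 1)) <= (v / H) `^ p.
  have vH : 0 < v / H / x by rewrite !divr_gt0.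
  have := ler_wpM2l (powR_ge0 x p) (powR_ge_bernoulli vH p1).
  by rewrite -powRM ?(ltW x0) ?(ltW vH)// [x * _]mulrC divfK ?gt_eqF.
have -> : (t + v) `^ p = (t + H) `^ p * x `^ p.
  rewrite -powRM ?(ltW S0) ?(ltW x0)//; congr powR.
  by rewrite /x mulrCA divff ?gt_eqF// mulr1.
rewrite ler_wpM2l ?powR_ge0//.
have th0 : 0 <= t / (t + H) by rewrite divr_ge0// ltW.
have th1 : 0 <= H / (t + H) by rewrite divr_ge0// ltW.
have := lerD (ler_wpM2l th0 h1) (ler_wpM2l th1 h2).
rewrite mulr1; apply: le_trans.
rewrite le_eqVlt; apply/orP; left; apply/eqP.
by rewrite /x; field; rewrite !gt_eqF.
Qed.

End shifted_powers.

(** * Removal of the upper truncation *)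

Section monotone_truncation.
Context d (T : measurableType d) (R : realType).
Variable mu : {measure set T -> \bar R}.

(** Monotone convergence along [m = k + 1]; at each point the sequence is eventually constant. *)
Lemma integral_powR_truncation_le (g : T -> R) (p : R) (C : \bar R) :
  measurable_fun setT g -> (forall x, 0 <= g x) -> 0 < p ->
  (forall m, 0 < m -> (\int[mu]_x ((Num.min (g x) m) `^ p)%:E <= C)%E) ->
  (\int[mu]_x (g x `^ p)%:E <= C)%E.
Proof.
move=> mg g0 p0 H.
pose h (k : nat) x := ((Num.min (g x) k.+1%:R) `^ p)%:E.
have mh k : measurable_fun setT (h k).
  apply/measurable_EFinP.
  apply: (measurableT_comp (@measurable_powR R p)).
  exact: measurable_minr.
have cvgh x : h k x @[k --> \oo] --> (g x `^ p)%:E.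
  apply: cvg_near_cst.
  have [N _ hN] : \forall k \near \oo, g x <= k%:R :> R by exact: nbhs_infty_ger.
  exists N => // k /= Nk; rewrite /h min_l// (le_trans (hN k Nk))// ler_nat.
  exact: leqnSn.
have nd x : nondecreasing_seq (h^~ x).
  move=> k l kl; rewrite lee_fin ge0_ler_powR ?nnegrE ?(ltW p0)//.
  - by rewrite le_min g0/=.
  - by rewrite le_min g0/=.
  - by rewrite le_min ge_min lexx/= ge_min ler_nat ltnS kl orbT.
have hl x : limn (h^~ x) = (g x `^ p)%:E by apply/cvg_lim => //; exact: cvgh.
have h0 k x : setT x -> (0 <= h k x)%E by move=> _; rewrite lee_fin powR_ge0.
under eq_integral do rewrite -hl.
rewrite monotone_convergence//.
apply: lime_le.
  apply: ereal_nondecreasing_is_cvgn => k l kl.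
  by apply: ge0_le_integral => // x _; [exact: h0|exact: (nd x _ _ kl)].
by apply: nearW => k; exact: H.
Qed.

End monotone_truncation.

(** * Choice of the truncation parameters *)

Section truncated_estimate.
Context {R : realType} {n : nat}.
Variables (alpha beta K D d : R) (Psi : 'rV[R]_n -> R).
Variable mu : probability (borel_rV R n) R.
Hypotheses (alpha_gt1 : 1 < alpha) (alpha_le2 : alpha <= 2).
Hypotheses (beta_ge2 : 2 <= beta) (K_ge1 : 1 <= K).
Hypotheses (PsiC : condC Psi) (PsiG : growth K alpha beta Psi).
Hypotheses (D_ge0 : 0 <= D) (d_ge0 : 0 <= d) (mu_dmLSI : dmLSI mu Psi D d).
Variables (f : 'rV[R]_n -> R) (p : R).
Hypotheses (lf : locally_lipschitz f) (beta_p : beta <= p).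

Let N (x : borel_rV R n) : R := luxemburg (Psi_scaled Psi p) (grad f x).
Let c := Num.max ((K * D) `^ alpha^-1) ((K * D) `^ beta^-1).

Let KD_le (g A B : R) : 0 < g -> 0 < A -> 0 < B ->
  (K * D) `^ g^-1 * A <= B -> K * D <= (B / A) `^ g.
Proof.
move=> g0 A0 B0 h.
have KD0 : 0 <= K * D by rewrite mulr_ge0// (le_trans ler01).
have -> : K * D = ((K * D) `^ g^-1) `^ g.
  by rewrite -powRrM mulVf ?gt_eqF// powRr1.
rewrite ge0_ler_powR ?nnegrE ?powR_ge0 ?(ltW g0)//.
  by rewrite divr_ge0// ltW.
by rewrite ler_pdivlMr.
Qed.

Let measurable_absf : measurable_fun setT (fun x : borel_rV R n => `|f x|).
Proof.
apply: (measurableT_comp (@normr_measurable R setT)).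
exact: continuous_measurable_rV (locally_lipschitz_continuous lf).
Qed.

(** The slack [F0 < F] leaves room for [eps] when [d <= beta], and keeps the threshold positive
    otherwise. [A] and [B] stand for the norm of the gradient and its multiple by [c], kept positive
    even if these vanish. *)
Lemma integral_truncation_le (A B F0 F m : R) : 0 < A -> 0 < B -> c * A <= B ->
  D = 0 \/ (\int[mu]_x (N x `^ p)%:E <= (A `^ p)%:E)%E ->
  0 <= F0 -> F0 < F ->
  (\int[mu]_x (`|f x| `^ beta)%:E <= (F0 `^ beta)%:E)%E -> 0 < m ->
  (\int[mu]_x ((Num.min `|f x| m) `^ p)%:E <=
    ((expR (2 * d / beta) * F + 2 * expR 1 / (alpha - 1) * B) `^ p)%:E)%E.
Proof.
move=> A0 B0 cAB HA F00 F0F fF0 m0.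
have b2 := beta_ge2; have al1 := alpha_gt1; have bp := beta_p.
have b0 : 0 < beta by lra.
have al0 : 0 < alpha by lra.
have p0 : 0 < p by lra.
have Fgt0 : 0 < F by lra.
have p1 : 1 <= p by lra.
have KDa : K * D <= (B / A) `^ alpha.
  apply: KD_le => //; apply: le_trans cAB.
  by rewrite ler_wpM2r ?(ltW A0)// /c le_max lexx.
have KDb : K * D <= (B / A) `^ beta.
  apply: KD_le => //; apply: le_trans cAB.
  by rewrite ler_wpM2r ?(ltW A0)// /c le_max lexx orbT.
have mfb : measurable_fun setT (fun x : borel_rV R n => `|f x| `^ beta).
  exact: (measurableT_comp (@measurable_powR R beta) measurable_absf).
set C2 := 2 * expR 1 / (alpha - 1).
have momentE t eps s : 0 < eps -> eps < m -> 0 < s ->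
    (\int[mu]_x (truncf f t eps m x `^ s)%:E = (moment mu f t eps m s)%:E)%E.
  move=> e0 em s0; rewrite /moment /Rintegral fineK//.
  exact: (integrable_fin_num measurableT (integrable_truncf_powR mu _ lf e0 em s0)).
have m20 : 0 < m / 2 by lra.
have m2m : m / 2 < m by lra.
have [db|bd] := leP d beta.
  (* With [eps <= e1], replacing [|f|] by its maximum with [eps] raises the [beta]-norm bound from
     [F0] to at most [F]. *)
  pose e1 := (F `^ beta - F0 `^ beta) `^ beta^-1.
  have FF : 0 < F `^ beta - F0 `^ beta.
    rewrite subr_gt0 gt0_ltr_powR ?nnegrE ?(ltW Fgt0)//.
  have e10 : 0 < e1 by exact: powR_gt0.
  pose eps := Num.min e1 (m / 2).
  have eps0 : 0 < eps by rewrite lt_min e10.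
  have epsm : eps < m by rewrite gt_min m2m orbT.
  have epse : eps `^ beta <= F `^ beta - F0 `^ beta.
    apply: (@le_trans _ _ (e1 `^ beta)).
      by rewrite ge0_ler_powR ?nnegrE ?(ltW b0) ?(ltW eps0) ?(ltW e10)// ge_min lexx.
    by rewrite /e1 -powRrM mulVf ?gt_eqF// powRr1// ltW.
  have h1 := @momentnorm_le_small R n alpha beta K D d Psi mu alpha_gt1 alpha_le2
    beta_ge2 K_ge1 PsiC PsiG D_ge0 mu_dmLSI f p 0 eps m A B lf beta_p (lexx 0)
    eps0 epsm A0 B0 KDa KDb HA d_ge0 db.
  have h2 : momentnorm mu f 0 eps m beta <= F.
    rewrite /momentnorm -[leRHS]powRr1 ?(ltW Fgt0)// -(mulfV (lt0r_neq0 b0)) powRrM.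
    rewrite ge0_ler_powR ?nnegrE ?invr_ge0 ?powR_ge0 ?(ltW b0)//.
      by rewrite ltW// (moment_gt0 mu _ lf eps0 epsm).
    rewrite -lee_fin -momentE//.
    apply: (@le_trans _ _ (\int[mu]_x ((`|f x| `^ beta)%:E + (eps `^ beta)%:E))%E).
      apply: ge0_le_integral_nonmeas => x; first by rewrite lee_fin powR_ge0.
      rewrite -EFinD lee_fin /truncf /trunc subr0.
      have le : Num.min (Num.max `|f x| eps) m <= Num.max `|f x| eps by rewrite ge_min lexx.
      apply: (@le_trans _ _ (Num.max `|f x| eps `^ beta)).
        rewrite ge0_ler_powR ?nnegrE ?(ltW b0)//.
          by rewrite le_min le_max normr_ge0/= ltW.
        by rewrite le_max normr_ge0.
      by case: (leP `|f x| eps) => _; rewrite ?lerDr ?lerDl powR_ge0.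
    rewrite ge0_integralD//; [|exact/measurable_EFinP|
      by move=> x _; rewrite lee_fin powR_ge0].
    rewrite integral_cst//; have /= -> := probability_setT mu; rewrite mule1.
    apply: (@le_trans _ _ ((F0 `^ beta)%:E + (eps `^ beta)%:E)%E); first exact: leeD2r.
    by rewrite -EFinD lee_fin addrC -lerBrDr.
  have e12 : expR (d / beta) <= expR (2 * d / beta).
    rewrite ler_expR ler_wpM2r ?invr_ge0 ?(ltW b0)//.
    by rewrite ler_peMl// ler1n.
  have h3 : momentnorm mu f 0 eps m p <= expR (2 * d / beta) * F + C2 * B.
    apply: (le_trans h1); rewrite lerD2r ler_pM ?expR_ge0//.
    by rewrite ltW// momentnorm_gt0.
  apply: (@le_trans _ _ (\int[mu]_x (truncf f 0 eps m x `^ p)%:E)%E).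
    apply: ge0_le_integral_nonmeas => x; first by rewrite lee_fin powR_ge0.
    rewrite lee_fin ge0_ler_powR ?nnegrE ?(ltW p0)//.
    - by rewrite le_min normr_ge0 ltW.
    - by rewrite (le_trans (ltW eps0))//; have /andP[] := truncf_itv f 0 epsm x.
    - by rewrite /truncf /trunc subr0 le_min ge_min le_max lexx/= ge_min lexx orbT.
  rewrite momentE// lee_fin -(momentnormK mu _ lf eps0 epsm p0).
  have mn0 := momentnorm_gt0 mu 0 lf eps0 epsm p0.
  by rewrite ge0_ler_powR ?nnegrE ?(ltW p0) ?(ltW mn0)//; exact: le_trans (ltW mn0) h3.
have d0 : 0 < d := lt_trans b0 bd.
(* This threshold brings the [beta]-moment of [|f| / t] down to [expR (- (2 * d))]. *)
pose t := expR (2 * d / beta) * F.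
have t0 : 0 < t by rewrite mulr_gt0 ?expR_gt0.
have dp0 : 0 < 16 * d * p by rewrite !mulr_gt0.
pose eps := Num.min (B / (16 * d * p)) (m / 2).
have eps0 : 0 < eps by rewrite lt_min m20 divr_gt0.
have epsm : eps < m by rewrite gt_min m2m orbT.
have epsB : 16 * d * p * eps <= B.
  by rewrite mulrC -ler_pdivlMr// ge_min lexx.
have mG : measurable_fun setT (fun x : borel_rV R n => (`|f x| / t) `^ beta).
  apply: (measurableT_comp (@measurable_powR R beta)).
  exact: measurable_funM.
have intG : (\int[mu]_x ((`|f x| / t) `^ beta)%:E <= (expR (- (2 * d)))%:E)%E.
  have GE x : ((`|f x| / t) `^ beta)%:E = ((t `^ beta)^-1%:E * (`|f x| `^ beta)%:E)%E.
    rewrite -EFinM; congr EFin; rewrite powRM ?invr_ge0 ?(ltW t0)// mulrC; congr (_ * _).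
    exact: powRV.
  under eq_integral do rewrite GE.
  rewrite ge0_integralZl//; [|exact/measurable_EFinP|
    by rewrite lee_fin invr_ge0 powR_ge0].
  apply: (@le_trans _ _ ((t `^ beta)^-1%:E * (F `^ beta)%:E)%E).
    apply: lee_wpmul2l; first by rewrite lee_fin invr_ge0 powR_ge0.
    apply: (le_trans fF0); rewrite lee_fin.
    by rewrite ge0_ler_powR ?nnegrE ?(ltW b0) ?(ltW Fgt0)// ltW.
  rewrite -EFinM lee_fin le_eqVlt; apply/orP; left; apply/eqP.
  rewrite !powRE// -expRN -expRD; congr expR.
  rewrite /t lnM ?posrE ?expR_gt0// expRK; field.
  by rewrite gt_eqF.
have iG : mu.-integrable setT (EFin \o (fun x : borel_rV R n => (`|f x| / t) `^ beta)).
  apply/integrableP; split; first exact/measurable_EFinP.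
  apply: (@le_lt_trans _ _ (expR (- (2 * d)))%:E); last by rewrite ltry.
  apply: le_trans intG; apply: ge0_le_integral_nonmeas => // x.
  by rewrite /= ger0_norm// powR_ge0.
have intG' : \int[mu]_x ((fun x : borel_rV R n => (`|f x| / t) `^ beta) x) <= expR (- (2 * d)).
  rewrite -lee_fin /Rintegral fineK//; exact: (integrable_fin_num measurableT iG).
have h1 := @momentnorm_le_large R n alpha beta K D d Psi mu alpha_gt1 alpha_le2
    beta_ge2 K_ge1 PsiC PsiG D_ge0 mu_dmLSI f p t eps m A B lf beta_p (ltW t0)
    eps0 epsm A0 B0 KDa KDb HA bd t0 epsB iG intG'.
set H := momentnorm mu f t eps m p in h1.
have H0 : 0 < H by exact: (momentnorm_gt0 mu _ lf eps0 epsm p0).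
have tH0 : 0 < t + H by rewrite addr_gt0.
have tr0 x : 0 < truncf f t eps m x.
  by rewrite (lt_le_trans eps0)//; have /andP[] := truncf_itv f t epsm x.
pose S := (t + H) `^ p.
have S0 : 0 <= S by exact: powR_ge0.
(* Coefficients of the convexity bound for [t] plus the truncation, whose [p]-norm is [H]; the
   integrated bound is exactly [S]. *)
pose k1 := S * (t / (t + H)); pose k2 := S * (H / (t + H)) / H `^ p.
have k10 : 0 <= k1 by rewrite mulr_ge0// divr_ge0// ltW.
have k20 : 0 <= k2 by rewrite divr_ge0 ?powR_ge0// mulr_ge0// divr_ge0// ltW.
apply: (@le_trans _ _ (\int[mu]_x (k1%:E + k2%:E * (truncf f t eps m x `^ p)%:E))%E).
  apply: ge0_le_integral_nonmeas => x; first by rewrite lee_fin powR_ge0.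
  rewrite -EFinM -EFinD lee_fin.
  apply: (@le_trans _ _ ((t + truncf f t eps m x) `^ p)).
    rewrite ge0_ler_powR ?nnegrE ?(ltW p0)//.
    - by rewrite le_min normr_ge0 ltW.
    - by rewrite addr_ge0 ?ltW.
    - exact/trunc_add_ge/ltW.
  apply: (le_trans (powR_add_le (ltW t0) (tr0 x) H0 p1)).
  rewrite powRM ?invr_ge0 ?(ltW H0) ?(ltW (tr0 x))//.
  rewrite powRV// -/S le_eqVlt; apply/orP; left; apply/eqP.
  by rewrite /k1 /k2; ring.
have mup : measurable_fun setT (fun x => (truncf f t eps m x `^ p)%:E).
  by apply/measurable_EFinP; exact: measurable_truncf_powR.
have kge0 x : (0 <= k2%:E * (truncf f t eps m x `^ p)%:E)%E.
  by rewrite mule_ge0 ?lee_fin ?powR_ge0.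
rewrite ge0_integralD//; last exact: measurable_funeM.
rewrite integral_cst//; have /= -> := probability_setT mu; rewrite mule1.
rewrite ge0_integralZl//; last by move=> x _; rewrite lee_fin powR_ge0.
rewrite momentE// -(momentnormK mu _ lf eps0 epsm p0) -/H -EFinM -EFinD lee_fin.
have -> : k1 + k2 * H `^ p = S.
  by rewrite /k1 /k2; field; rewrite !gt_eqF// powR_gt0.
rewrite ge0_ler_powR ?nnegrE ?(ltW p0) ?(ltW tH0)//.
  by rewrite addr_ge0 ?(ltW t0)//; exact: le_trans (ltW H0) h1.
by rewrite lerD2l.
Qed.

End truncated_estimate.

(** * Passage from strict real bounds to the norms themselves *)

Theorem theorem3p1 (R : realType) (n : nat) (alpha beta K D d : R)
    (Psi : 'rV[R]_n -> R) (mu : probability (borel_rV R n) R)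
    (alpha_gt1 : 1 < alpha) (alpha_le2 : alpha <= 2) (beta_ge2 : 2 <= beta)
    (K_ge1 : 1 <= K) (PsiC : condC Psi) (PsiG : growth K alpha beta Psi)
    (D_ge0 : 0 <= D) (d_ge0 : 0 <= d)
    (mu_ac : mu `<< lebesgue_rV n) (mu_dmLSI : dmLSI mu Psi D d) :
  forall (f : 'rV[R]_n -> R) (p : R), locally_lipschitz f -> beta <= p ->
    (Lnorm mu p%:E (EFin \o f) <=
      (expR (2 * d / beta))%:E * Lnorm mu beta%:E (EFin \o f)
      + (2 * expR 1 / (alpha - 1)
         * Num.max ((K * D) `^ alpha^-1) ((K * D) `^ beta^-1))%:E
        * Lnorm mu p%:E
            (fun x => (luxemburg (Psi_scaled Psi p) (grad f x))%:E))%E.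
Proof.
move=> f p lf beta_p.
have b0 : 0 < beta by lra.
have p0 : 0 < p by lra.
have al0 : 0 < alpha by lra.
have a0 : 0 < alpha - 1 by lra.
have K0 : 0 < K by lra.
pose N (x : borel_rV R n) : R := luxemburg (Psi_scaled Psi p) (grad f x).
have N0 x : 0 <= N x by exact: luxemburg_ge0.
set c := Num.max _ _; set C1 := expR (2 * d / beta).
pose C2 := 2 * expR 1 / (alpha - 1).
rewrite -[X in (X * c)%:E]/C2.
have C10 : 0 < C1 by exact: expR_gt0.
have C20 : 0 < C2 by rewrite divr_gt0// mulr_gt0// expR_gt0.
have c0 : 0 <= c by rewrite le_max powR_ge0.
have LfE r : 0 < r -> (\int[mu]_x (`|f x| `^ r)%:E = Lnorm mu r%:E (EFin \o f) `^ r)%E.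
  by move=> r0; rewrite poweR_Lnorm ?gt_eqF.
have LNE : (\int[mu]_x (N x `^ p)%:E = Lnorm mu p%:E (EFin \o N) `^ p)%E.
  rewrite (poweR_Lnorm mu _ (lt0r_neq0 p0)); apply: eq_integral => x _.
  by rewrite /= (ger0_norm (N0 x)).
have mf : measurable_fun setT (fun x : borel_rV R n => `|f x|).
  apply: (measurableT_comp (@normr_measurable R setT)).
  exact: continuous_measurable_rV (locally_lipschitz_continuous lf).
have pow_le (x : \bar R) (y r : R) : 0 < r -> (0 <= x)%E -> 0 <= y ->
    (x <= y%:E)%E -> (x `^ r <= (y `^ r)%:E)%E.
  move=> r0 x0 y0 xy; rewrite -poweR_EFin gt0_ler_poweR ?(ltW r0)//.
    by rewrite in_itv/= x0 leey.
  by rewrite in_itv/= lee_fin y0 leey.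
have core (A B F0 F : R) : 0 < A -> 0 < B -> c * A <= B ->
    D = 0 \/ (Lnorm mu p%:E (EFin \o N) <= A%:E)%E -> 0 <= F0 -> F0 < F ->
    (Lnorm mu beta%:E (EFin \o f) <= F0%:E)%E ->
    (Lnorm mu p%:E (EFin \o f) <= (C1 * F + C2 * B)%:E)%E.
  move=> A0 B0 cAB HA F00 F0F fF0.
  have S0 : 0 <= C1 * F + C2 * B.
    by rewrite addr_ge0// mulr_ge0 ?(ltW C10) ?(ltW C20) ?(ltW B0)// (le_trans F00)// ltW.
  have HA' : D = 0 \/ (\int[mu]_x (N x `^ p)%:E <= (A `^ p)%:E)%E.
    by case: HA => [|h]; [left|right; rewrite LNE; exact: (pow_le _ _ _ p0 (Lnorm_ge0 _ _ _) (ltW A0) h)].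
  have fF0' : (\int[mu]_x (`|f x| `^ beta)%:E <= (F0 `^ beta)%:E)%E.
    rewrite LfE//; exact: (pow_le _ _ _ b0 (Lnorm_ge0 _ _ _) F00 fF0).
  have H : (\int[mu]_x (`|f x| `^ p)%:E <= ((C1 * F + C2 * B) `^ p)%:E)%E.
    apply: (integral_powR_truncation_le mf _ p0) => [x|m m0]; first exact: normr_ge0.
    exact: (integral_truncation_le alpha_gt1 alpha_le2 beta_ge2 K_ge1 PsiC PsiG
      D_ge0 d_ge0 mu_dmLSI lf beta_p A0 B0 cAB HA' F00 F0F fF0' m0).
  have pi0 : 0 < p^-1 by rewrite invr_gt0.
  have := pow_le _ _ _ pi0 (integral_ge0 _ _) (powR_ge0 _ _) H.
  rewrite -powRrM divff ?gt_eqF// powRr1// LfE// -poweRrM divff ?gt_eqF// poweRe1 ?Lnorm_ge0//.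
  by apply => x _; rewrite lee_fin powR_ge0.
have Lb0 : (0 <= Lnorm mu beta%:E (EFin \o f))%E by exact: Lnorm_ge0.
have LN0 : (0 <= Lnorm mu p%:E (EFin \o N))%E by exact: Lnorm_ge0.
rewrite -/(EFin \o N) in LN0 *.
have r0 : (0 <= (C2 * c)%:E * Lnorm mu p%:E (EFin \o N))%E.
  by rewrite mule_ge0// lee_fin mulr_ge0// ltW.
move: Lb0 core.
(* An infinite [beta]-norm makes the right side infinite because [C1] is positive. *)
case: (Lnorm mu beta%:E (EFin \o f)) => [b b_ge0 core|_ _|//]; last first.
  by rewrite gt0_muley ?lte_fin// addye ?leey// gt_eqF// (lt_le_trans _ r0)// ltNyr.
rewrite lee_fin in b_ge0.
(* If [D = 0] then [c = 0], and the last term is 0 even for a gradient of infinite norm; [B] can be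
   any positive number, here chosen to contribute [e / 2]. *)
have [D00|Dn0] := eqVneq D 0.
  have c00 : c = 0 by rewrite /c D00 mulr0 !powR0 ?invr_eq0 ?gt_eqF// maxxx.
  rewrite c00 mulr0 mul0e adde0 -EFinM; apply/lee_addgt0Pr => e e0.
  have e2 : 0 < e / 2 by rewrite divr_gt0.
  have := core 1 (e / 2 / C2) b (b + e / 2 / C1) ltr01 (divr_gt0 e2 C20).
  rewrite c00 mul0r ltrDl !divr_gt0// => /(_ _ (or_introl D00) b_ge0 isT (lexx _)).
  rewrite (ltW (divr_gt0 e2 C20)) => /(_ isT) /le_trans; apply.
  rewrite -EFinD lee_fin le_eqVlt; apply/orP; left; apply/eqP.
  by field; rewrite !gt_eqF.
have D0 : 0 < D by rewrite lt_neqAle eq_sym Dn0.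
have cgt0 : 0 < c by rewrite lt_max powR_gt0// mulr_gt0.
have C2c : 0 < C2 * c by rewrite mulr_gt0.
move: LN0 r0 core; case: (Lnorm mu p%:E (EFin \o N)) => [l l0 _ core|_ _ _|//]; last first.
  by rewrite gt0_muley ?lte_fin// addey ?leey// -EFinM.
rewrite lee_fin in l0.
rewrite -!EFinM -EFinD; apply/lee_addgt0Pr => e e0.
(* Raising both norms by [dl] raises the right side by exactly [e]. *)
pose dl := e / (C1 + C2 * c).
have dl0 : 0 < dl by rewrite divr_gt0// addr_gt0.
have ldl : 0 < l + dl by rewrite ltr_wpDl.
have := core (l + dl) (c * (l + dl)) b (b + dl) ldl (mulr_gt0 cgt0 ldl) (lexx _)
  (or_intror _) b_ge0 _ (lexx _).
rewrite lee_fin lerDl (ltW dl0) ltrDl dl0 => /(_ isT isT)/le_trans; apply.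
rewrite -EFinD lee_fin le_eqVlt; apply/orP; left; apply/eqP.
by rewrite /dl; field; rewrite gt_eqF// addr_gt0.
Qed.
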